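(* Let $\alpha>0$ and let $r\in C(0,+\infty)$ satisfy $r(x)>0$ for all $x>0$, $\int_0^1\frac{d\tau}{r(\tau)}=+\infty$ and $\int_1^\infty\frac{d\tau}{r(\tau)}=+\infty$. Let $X(y,t)$ ($t>0$, $y>0$) be defined by $\int_{X(y,t)}^y\frac{1}{r(\tau)}d\tau=t$. Then $$(U_0(t)f)(y):=\frac{r(X(y,t))f(X(y,t))}{r(y)}=f(X(y,t))\frac{\partial X(y,t)}{\partial y}$$ defines a positive $C_0$-semigroup $(U_0(t))_{t\ge0}$ on $X_\alpha$ if and only if $$\sup_{x>0}\frac{y(x,t)}{x}<+\infty\quad(t\ge0)$$ and $[0,+\infty)\ni t\mapsto\sup_{x>0}\frac{y(x,t)}{x}$ is locally bounded, where $y(x,t)>x$ is defined by $\int_x^{y(x,t)}\frac{1}{r(\tau)}d\tau=t$. In this case $$\|U_0(t)\|_{\mathcal{L}(X_\alpha)}=\sup_{x>0}\frac{y^\alpha(x,t)}{x^\alpha}.$$ This occurs if $C:=\sup_{z>0}\frac{r(z)}{z}<+\infty$, in which case $\|U_0(t)\|_{\mathcal{L}(X_\alpha)}\le e^{\alpha Ct}$.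
   Context: $X_{\alpha}:=L^1(\mathbb{R}_+;x^\alpha dx)$ with $\mathbb{R}_+=(0,+\infty)$. For $t>0$, $X(y,t)\in(0,y)$; for $t=0$, $X(y,0)=y$ and $y(x,0)=x$, so $U_0(0)$ is the identity. *)

(* Defs.v *)
From HB Require Import structures.
From mathcomp Require Import all_boot all_order all_algebra generic_quotient ring_quotient.
From mathcomp Require Import all_classical all_reals all_analysis measurable_realfun.

Set Implicit Arguments.
Unset Strict Implicit.
Unset Printing Implicit Defensive.
Import Order.TTheory GRing.Theory Num.Theory.
Import numFieldNormedType.Exports.

Local Open Scope classical_set_scope.
Local Open Scope ring_scope.
Local Open Scope quotient_scope.

Section L1_space.
Context d (T : measurableType d) (R : realType).
Variable mu : {measure set T -> \bar R}.

(* LfunType only excludes functions that are not measurable or not integrable;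
   it does not identify functions equal almost everywhere. *)
Definition L1fun : Type := LfunType mu (@lexx _ _ 1%E).
HB.instance Definition _ := GRing.Lmodule.on L1fun.

Definition ae_zero : {pred L1fun} := fun f => `[< \forall x \ae mu, f x = 0 >].

Lemma ae_zeroP (f : L1fun) : reflect (\forall x \ae mu, f x = 0) (f \in ae_zero).
Proof. exact: asboolP. Qed.

Lemma ae_zero_zmod_closed : zmod_closed ae_zero.
Proof.
split; first by apply/ae_zeroP; exact: aeW.
move=> f g /ae_zeroP f0 /ae_zeroP g0; apply/ae_zeroP.
apply: filterS2 f0 g0 => x fx gx.
by rewrite [LHS](_ : _ = f x - g x)// fx gx subr0.
Qed.

HB.instance Definition _ := GRing.isZmodClosed.Build L1fun ae_zero
  ae_zero_zmod_closed.

(* The library's LspaceType carries no vector space structure, so L^1 is built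
   as the quotient of the vector space of integrable functions by the subspace
   of almost everywhere null functions. *)
Definition L1 : Type := {ideal_quot ae_zero}.

HB.instance Definition _ := Choice.on L1.
HB.instance Definition _ := EqQuotient.on L1.
HB.instance Definition _ := GRing.Zmodule.on L1.
HB.instance Definition _ := @ZmodQuotient.on L1.

Definition L1_to_fun (u : L1) : T -> R := (repr u : L1fun).
Coercion L1_to_fun : L1 >-> Funclass.

Lemma L1_ind (P : L1 -> Prop) : (forall f, P (\pi f)) -> forall u, P u.
Proof. by move=> Pf u; rewrite -[u]reprK. Qed.

Lemma L1_eqP (f g : L1fun) :
  reflect (\forall x \ae mu, f x = g x) (f == g %[mod L1]).
Proof.
rewrite -[X in reflect _ X]Quotient.idealrBE.
apply: (iffP (ae_zeroP _)); apply: filterS => x.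
  by rewrite [X in X = 0 -> _](_ : _ = f x - g x)// => /eqP; rewrite subr_eq0 => /eqP.
by move=> fgx; rewrite [LHS](_ : _ = f x - g x)// fgx subrr.
Qed.

Definition L1_scale (a : R) (u : L1) : L1 := \pi_L1 (a *: (repr u : L1fun)).

Lemma L1_scale_pi a (f : L1fun) : L1_scale a (\pi f) = \pi_L1 (a *: f).
Proof.
apply/eqP/L1_eqP.
have /L1_eqP : \pi_L1 (repr (\pi_L1 f)) == \pi_L1 f by rewrite reprK.
apply: filterS => x fx; by rewrite [LHS](_ : _ = a * repr (\pi_L1 f) x)// fx.
Qed.

Let L1_scaleA a b u : L1_scale a (L1_scale b u) = L1_scale (a * b) u.
Proof. by elim/L1_ind: u => f; rewrite (L1_scale_pi b) !L1_scale_pi scalerA. Qed.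

Let L1_scale1 : left_id 1 L1_scale.
Proof. by elim/L1_ind => f; rewrite L1_scale_pi scale1r. Qed.

Let L1_scaleDr : right_distributive L1_scale +%R.
Proof.
move=> a; elim/L1_ind => f; elim/L1_ind => g.
by rewrite !L1_scale_pi -!pi_addr L1_scale_pi scalerDr.
Qed.

Let L1_scaleDl u : {morph L1_scale^~ u : a b / a + b}.
Proof.
by elim/L1_ind: u => f a b; rewrite !L1_scale_pi -!pi_addr scalerDl.
Qed.

HB.instance Definition _ := GRing.Zmodule_isLmodule.Build R L1
  L1_scaleA L1_scale1 L1_scaleDr L1_scaleDl.

Lemma measurable_abs_L1fun (f : L1fun) :
  measurable_fun [set: T] (abse \o (EFin \o f) : T -> \bar R).
Proof.
apply: measurableT_comp; first exact: abse_measurable.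
by apply/measurable_EFinP; exact: measurable_funP.
Qed.

Definition L1_norm (u : L1) : R := fine ('N[mu]_1 [EFin \o u])%E.

Lemma L1_norm_pi (f : L1fun) : L1_norm (\pi_L1 f) = fine ('N[mu]_1 [EFin \o f])%E.
Proof.
congr fine; rewrite !Lnorm1; apply: ae_eq_integral => //;
  try exact: measurable_abs_L1fun.
have /L1_eqP : \pi_L1 (repr (\pi_L1 f)) == \pi_L1 f by rewrite reprK.
by apply: filterS => x fx _; rewrite /= /L1_to_fun fx.
Qed.

Let L1_ler_normD u v : L1_norm (u + v) <= L1_norm u + L1_norm v.
Proof.
elim/L1_ind: u => f; elim/L1_ind: v => g.
by rewrite -pi_addr !L1_norm_pi ler_LnormD.
Qed.

Let L1_normZ a u : L1_norm (a *: u) = `|a| * L1_norm u.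
Proof.
elim/L1_ind: u => f; rewrite [_ *: _]L1_scale_pi !L1_norm_pi.
by apply: EFin_inj; rewrite finite_norm_fine LnormZ -finite_norm_fine.
Qed.

Let L1_norm_eq0 u : L1_norm u = 0 -> u = 0.
Proof.
elim/L1_ind: u => f; rewrite L1_norm_pi => /fine_Lnormr_eq0 f0.
rewrite -pi_zeror; apply/eqP/L1_eqP.
by apply: filterS f0 => x; exact.
Qed.

HB.instance Definition _ := Lmodule_isNormed.Build R L1
  L1_ler_normD L1_normZ L1_norm_eq0.

End L1_space.

Section semigroup.
Context (R : realType) (V : normedModType R).

Definition op_norm (A : V -> V) : \bar R :=
  ereal_sup [set `|A u|%:E | u in [set u : V | `|u| <= 1]].

(* Only the values S t with 0 <= t are relevant. *)
Definition C0_semigroup (S : R -> V -> V) : Prop :=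
  [/\ forall t, 0 <= t -> linear (S t) /\ continuous (S t),
      forall u, S 0 u = u,
      forall s t u, 0 <= s -> 0 <= t -> S (s + t) u = S s (S t u) &
      forall u, S t u @[t --> 0^'+] --> u].

End semigroup.

Definition positive_op d (T : measurableType d) (R : realType)
    (mu : {measure set T -> \bar R}) (A : L1 mu -> L1 mu) : Prop :=
  forall u : L1 mu,
    (\forall x \ae mu, 0 <= u x) -> \forall x \ae mu, 0 <= A u x.

Section weighted_measure.
Context (R : realType) (alpha : R).
Local Open Scope ereal_scope.

(* x^alpha dx on the open half-line, as a measure on R for which ]-oo, 0] is a
   null set: L1 xpow_measure is then L^1(]0, +oo[; x^alpha dx). *)
Definition xpow_measure (A : set (measurableTypeR R)) : \bar R :=
  \int[lebesgue_measure]_(x in A `&` `]0%R, +oo[) (x `^ alpha)%:E.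

Let xpow_measure0 : xpow_measure set0 = 0.
Proof. by rewrite /xpow_measure set0I integral_set0. Qed.

Let xpow_measure_ge0 A : 0 <= xpow_measure A.
Proof. by apply: integral_ge0 => x _; rewrite lee_fin powR_ge0. Qed.

Let xpow_measure_semi_sigma_additive : semi_sigma_additive xpow_measure.
Proof.
move=> F mF tF mUF; rewrite /xpow_measure setI_bigcupl ge0_integral_bigcup/=.
- apply: is_cvg_ereal_nneg_natsum_cond => n _ _.
  by apply: integral_ge0 => x _; rewrite lee_fin powR_ge0.
- by move=> k; apply: measurableI.
- apply/measurable_EFinP/measurable_funTS; exact: measurable_powR.
- by move=> x _; rewrite lee_fin powR_ge0.
- exact: trivIset_setIr.
Qed.

HB.instance Definition _ := isMeasure.Build _ _ _ xpow_measure
  xpow_measure0 xpow_measure_ge0 xpow_measure_semi_sigma_additive.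

End weighted_measure.

Notation Xspace alpha := (L1 (xpow_measure alpha)).

Section characteristics.
Context (R : realType).
Variable r : R -> R.

Definition travel_time (x y : R) : \bar R :=
  (\int[lebesgue_measure]_(tau in `[x, y]) ((r tau)^-1)%:E)%E.

(* The point reached from y backwards (charX), resp. from x forwards (chary),
   after time t. For t = 0 the endpoint itself is the only solution, and for
   0 < t a solution is necessarily distinct from it. *)
Definition charX (y t : R) : R :=
  get [set x : R | 0 < x <= y /\ travel_time x y = t%:E].

Definition chary (x t : R) : R :=
  get [set y : R | x <= y /\ travel_time x y = t%:E].

Definition U0 (t : R) (f : R -> R) (y : R) : R :=
  r (charX y t) * f (charX y t) / r y.

Definition growth (t : R) : \bar R :=
  ereal_sup [set (chary x t / x)%:E | x in `]0, +oo[].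

(* S is the family of operators on L^1(]0, +oo[; x^alpha dx) given on
   representatives by U0 (in particular U0 t f depends on the class of f only),
   and it is a positive C_0-semigroup. *)
Definition U0_positive_semigroup (alpha : R)
    (S : R -> Xspace alpha -> Xspace alpha) : Prop :=
  [/\ forall t (f : L1fun (xpow_measure alpha)), 0 <= t ->
        \forall y \ae xpow_measure alpha, S t (\pi f) y = U0 t f y,
      C0_semigroup S &
      forall t, 0 <= t -> positive_op (S t)].

End characteristics.

Definition locally_bounded_nneg (R : realType) (phi : R -> \bar R) : Prop :=
  forall t0 : R, 0 <= t0 ->
    exists M : R, \forall t \near t0, (0 <= t)%R -> (phi t <= M%:E)%E.

(* Main.v *)
From HB Require Import structures.
Require Import Defs.
From mathcomp Require finmap.
From mathcomp Require Import all_boot all_order all_algebra.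
From mathcomp Require Import lra.
From mathcomp Require Import all_classical all_reals all_analysis measurable_realfun.

Set Implicit Arguments.
Unset Strict Implicit.
Unset Printing Implicit Defensive.
Import Order.TTheory GRing.Theory Num.Theory.
Import numFieldNormedType.Exports.

Local Open Scope classical_set_scope.
Local Open Scope ring_scope.

(** The whole statement follows from a change of the time variable. Let
    h(x) be the integral of 1/r from 1 to x; this is [clock]. Both improper
    integrals of 1/r diverge, so h is an increasing bijection of ]0, +oo[ onto
    the line, with inverse [clockV], and the characteristics become translations:
    X(y, t) = h^-1(h(y) - t) and y(x, t) = h^-1(h(x) + t) ([charXE], [charyE]).
    Differentiating the first formula gives r(X)/r(y) for the derivative of X in y.

    The measure dx/r(x) is the image of the Lebesgue measure under h^-1
    ([integral_clockV]); translations preserve the latter, so the flow preserves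
    the former. In terms of x^alpha dx this invariance reads
      (integral of |U0(t) f| y^alpha dy) = (integral of |f(x)| y(x, t)^alpha dx),
    which is [integral_transport], and the norm estimates all come from it. If
    y(x, t)^alpha <= K x^alpha for every x, then U0(t) is bounded by K. Conversely,
    if U0(t) is bounded by K, testing on the indicator of ]x, x1] and letting x1
    decrease to x gives that inequality at x ([weight_bound_of_norm_le]). Hence the
    formula for the operator norm, and U0(t) is bounded exactly when
    sup y(x, t)/x is finite. Since y(x, t) increases with t, so does this
    supremum, and finiteness at every t yields local boundedness
    ([locally_bounded_growth]).

    It remains to see that bounded operators U0(t) are strongly continuous at 0.
    They are bounded uniformly for t in [0, 1], so convergence need only be checked
    on a total subset of the space. The functions 1_]a, b] / r are total
    ([L1_indic_itv_total]), and U0(t) sends such a function to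
    1_]y(a, t), y(b, t)] / r. After the change of variables, the difference of the
    two is supported by two intervals of length t, so its norm is O(t)
    ([transport_pace_on_le]).

    Finally, if r(x) <= C x, then C h(x) - ln x is nondecreasing, which gives
    y(x, t) <= x e^(C t) ([growth_exp]). *)

(** * Measures with a density, and auxiliary inequalities *)

Section density.
Context d (T : measurableType d) (R : realType).
Variables (mu m : {measure set T -> \bar R}) (w : T -> R).
Hypothesis mw : measurable_fun [set: T] w.
Hypothesis w0 : forall x, 0 <= w x.
Hypothesis mE : forall A, measurable A -> m A = (\int[mu]_(x in A) (w x)%:E)%E.

Import HBNNSimple.

Lemma ge0_integral_density (f : T -> \bar R) :
  measurable_fun [set: T] f -> (forall x, 0 <= f x)%E ->
  (\int[m]_x f x = \int[mu]_x (f x * (w x)%:E))%E.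
Proof.
move=> mf f0.
pose f_ := nnsfun_approx measurableT mf.
transitivity (limn (fun n => \int[m]_x (f_ n x)%:E)%E).
  rewrite -monotone_convergence//.
  - apply: eq_integral => y _; apply/esym/cvg_lim => //.
    by apply: cvg_nnsfun_approx.
  - by move=> n; exact/measurable_EFinP.
  - by move=> n y _; rewrite lee_fin.
  - by move=> y _ a b ab; rewrite lee_fin; exact/lefP/nd_nnsfun_approx.
transitivity (limn (fun n => \int[mu]_x ((f_ n x)%:E * (w x)%:E))%E); last first.
  rewrite -monotone_convergence//.
  - apply: eq_integral => y _; apply/cvg_lim => //.
    by apply: cvgeZr => //; exact: cvg_nnsfun_approx.
  - by move=> n; apply: emeasurable_funM; exact/measurable_EFinP.
  - by move=> n y _; rewrite mule_ge0 ?lee_fin.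
  - by move=> y _ a b ab; rewrite lee_wpmul2r ?lee_fin//; exact/lefP/nd_nnsfun_approx.
congr (limn _); apply/funext => n.
transitivity (\sum_(k \in range (f_ n))
    \int[m]_x (k * \1_(f_ n @^-1` [set k]) x)%:E)%E.
  under eq_integral do rewrite fimfunE -fsumEFin//.
  rewrite ge0_integral_fsum//.
  - by move=> y; exact/measurable_EFinP/measurable_funM.
  - by move=> y x _; rewrite nnfun_muleindic_ge0.
transitivity (\sum_(k \in range (f_ n))
    \int[mu]_x ((k * \1_(f_ n @^-1` [set k]) x)%:E * (w x)%:E))%E; last first.
  rewrite -ge0_integral_fsum//.
  - apply: eq_integral => x _; rewrite [X in _ = (X%:E * _)%E]fimfunE -fsumEFin//.
    rewrite ge0_mule_fsuml//; first by move=> ?; rewrite nnfun_muleindic_ge0.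
  - by move=> y; apply: emeasurable_funM; apply/measurable_EFinP => //; exact/measurable_funM.
  - by move=> y x _; rewrite mule_ge0 ?nnfun_muleindic_ge0 ?lee_fin// nnfun_muleindic_ge0.
apply: eq_fsbigr => k /set_mem[x _ fxk].
have k0 : (0 <= k)%R by rewrite -fxk.
have mk : measurable (f_ n @^-1` [set k]) by [].
under eq_integral do rewrite EFinM.
under [RHS]eq_integral do rewrite EFinM -muleA.
rewrite ge0_integralZl//; last exact/measurable_EFinP.
rewrite ge0_integralZl//; last 2 first.
- by apply: emeasurable_funM; exact/measurable_EFinP.
- by move=> y _; rewrite mule_ge0// lee_fin.
rewrite integral_indic// setIT mE//.
congr (_ * _)%E; rewrite integral_mkcond; apply: eq_integral => y _.
rewrite patchE indicE; case: ifPn => _; by rewrite ?mul1e ?mul0e.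
Qed.
End density.

Section density_measure.
Context d (T : measurableType d) (R : realType) (mu : {measure set T -> \bar R}).
Variables (w : T -> R) (mw : measurable_fun [set: T] w) (w0 : forall x, 0 <= w x).

(** The two proofs are arguments of the definition so that the measure structure
    can be inferred from the term. *)
Definition density_measure of measurable_fun [set: T] w & (forall x, 0 <= w x) :=
  fun A : set T => (\int[mu]_(x in A) (w x)%:E)%E.

Local Notation nu := (density_measure mw w0).

Let nu0 : nu set0 = 0%E.
Proof. exact: integral_set0. Qed.

Let nu_ge0 A : (0 <= nu A)%E.
Proof. by apply: integral_ge0 => x _; rewrite lee_fin. Qed.

Let nu_sigma_additive : semi_sigma_additive nu.
Proof.
move=> F mF tF mUF; rewrite /density_measure ge0_integral_bigcup//=.
- apply: is_cvg_ereal_nneg_natsum_cond => n _ _.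
  by apply: integral_ge0 => x _; rewrite lee_fin.
- by apply/measurable_EFinP; exact: measurable_funTS.
- by move=> x _; rewrite lee_fin.
Qed.

HB.instance Definition _ := isMeasure.Build _ _ _ nu nu0 nu_ge0 nu_sigma_additive.

End density_measure.

Lemma lebesgue_integral_shift (R : realType) (t : R) (g : R -> \bar R) :
  measurable_fun [set: R] g -> (forall s, 0 <= g s)%E ->
  (\int[lebesgue_measure]_s g (s + t)%R = \int[lebesgue_measure]_s g s)%E.
Proof.
move=> mg g0.
have ms : measurable_fun [set: measurableTypeR R] (fun s : measurableTypeR R => s + t : measurableTypeR R).
  exact: measurable_funD.
pose sh : {mfun measurableTypeR R >-> measurableTypeR R} :=
  HB.pack (fun s : measurableTypeR R => s + t : measurableTypeR R) (isMeasurableFun.Build _ _ _ _ _ ms).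
have E := ge0_integral_pushforward ms lebesgue_measure measurableT mg (in1W (fun x => g0 x)).
rewrite preimage_setT in E; rewrite -[LHS]E.
apply: eq_measure_integral => A mA _.
apply: esym; apply: (@lebesgue_measure_unique _ (pushforward lebesgue_measure sh)) => // _ [[a b] _ <-].
transitivity (lebesgue_measure (`]a - t, b - t] : set (measurableTypeR R))); last first.
  congr lebesgue_measure.
  by rewrite predeqE => x /=; rewrite !in_itv/= ltrBlDr lerBrDr.
rewrite !lebesgue_measure_itv/= !lte_fin ltrD2r.
by case: ifP => // _; rewrite -!EFinB opprB addrA subrK.
Qed.

(** An interval and its translate by t differ only on the two intervals of length
    t that start at the end points. The bound on s controls, later on, a weight
    that multiplies the difference and grows with s. *)
Lemma indic_shift_diff_le (R : realType) (A B s t : R) : 0 <= t -> A <= B ->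
  let P : R := `|\1_(`]A, B]) (s - t) - \1_(`]A, B]) s| in
  P <= \1_(`]A, A + t]) s + \1_(`]B, B + t]) s /\ (P != 0 -> s <= B + t).
Proof.
move=> t0 AB /=; rewrite !indicE !mem_setE !in_itv/= ltrBrDr lerBlDr.
have [sa|sa] := ltP A s; have [sb|sb] := leP s B;
  have [sat|sat] := ltP (A + t) s; have [sbt|sbt] := leP s (B + t) => //=;
  rewrite ?subrr ?subr0 ?sub0r ?normrN ?normr0 ?normr1 ?eqxx ?oner_eq0//;
  split => //; lra.
Qed.

(** Both sides of the formula for the operator norm may be infinite; comparing
    their real upper bounds treats the finite and the infinite case together. *)
Lemma eq_ereal_real_ub (R : realType) (a b : \bar R) :
  (forall K : R, (a <= K%:E)%E <-> (b <= K%:E)%E) -> a = b.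
Proof.
suff H (x y : \bar R) : (forall K : R, (x <= K%:E)%E -> (y <= K%:E)%E) -> (y <= x)%E.
  by move=> ab; apply/eqP; rewrite eq_le !H// => K /ab.
case: x => [x||] H; [exact: H|by rewrite leey|].
move: (H (fine y - 1)) => /(_ (leNye _)); case: y {H} => [y||]//.
by rewrite lee_fin lerDl oppr_ge0 ler10.
Qed.

Lemma op_norm_leP (R : realType) (V : normedModType R) (A : V -> V) (K : R) :
  linear A -> (op_norm A <= K%:E)%E <-> 0 <= K /\ forall u, `|A u| <= K * `|u|.
Proof.
move=> lA; split => [H|[K0 H]].
  have AK u : `|u| <= 1 -> `|A u| <= K.
    move=> u1; rewrite -lee_fin; apply: le_trans H; apply: ereal_sup_ubound.
    by exists u.
  have K0 : 0 <= K by apply: le_trans (AK 0 _); rewrite ?normr0.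
  have AZ c u : A (c *: u) = c *: A u.
    have A0 : A 0 = 0.
      by have := lA (-1) 0 0; rewrite scaler0 add0r scaleN1r addNr.
    by have := lA c u 0; rewrite !addr0 A0 addr0.
  split=> // u; have [->|u0] := eqVneq u 0.
    by have := AZ 0 0; rewrite !scale0r => ->; rewrite normr0 mulr0.
  have nu0 : 0 < `|u| by rewrite normr_gt0.
  have := AK (`|u|^-1 *: u).
  rewrite AZ !normrZ normfV normr_id mulVf ?gt_eqF// => /(_ (lexx _)).
  by rewrite mulrC ler_pdivrMr.
apply: ge_ereal_sup => _ [u /= u1 <-]; rewrite lee_fin (le_trans (H u))//.
by rewrite ler_piMr.
Qed.

(** * Integrable functions modulo null sets *)

Section L1_interface.
Local Open Scope quotient_scope.
Context d (T : measurableType d) (R : realType).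
Variable mu : {measure set T -> \bar R}.
Implicit Types u v : L1 mu.

Lemma L1_pi_ae (f : L1fun mu) : \forall x \ae mu, (\pi_(L1 mu) f : L1 mu) x = f x.
Proof. by apply/L1_eqP; rewrite reprK. Qed.

Lemma L1_ext u v : (\forall x \ae mu, u x = v x) -> u = v.
Proof. by move=> uv; rewrite -[u]reprK -[v]reprK; apply/eqP/L1_eqP. Qed.

Lemma L1_addE u v : \forall x \ae mu, (u + v : L1 mu) x = u x + v x.
Proof.
have aux w : w = \pi_(L1 mu) (repr u + repr v : L1fun mu) ->
    \forall x \ae mu, (w : L1 mu) x = u x + v x by move=> ->; exact: L1_pi_ae.
by apply: aux; rewrite pi_addr !reprK.
Qed.

Lemma L1_scaleE a u : \forall x \ae mu, (a *: u : L1 mu) x = a * u x.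
Proof. exact: L1_pi_ae. Qed.

Lemma L1_subE u v : \forall x \ae mu, (u - v : L1 mu) x = u x - v x.
Proof.
have := L1_addE u (- v); have := L1_scaleE (-1) v; rewrite scaleN1r.
by apply: filterS2 => x vE ->; rewrite [X in _ + X]vE mulN1r.
Qed.

Lemma L1_measurable u : measurable_fun [set: T] (u : T -> R).
Proof. exact: measurable_funP. Qed.

Lemma L1_integrable u : mu.-integrable [set: T] (EFin \o (u : T -> R)).
Proof. exact/Lfun1_integrable/LfunP. Qed.

Lemma L1_normE u : `|u|%:E = (\int[mu]_x `|u x|%:E)%E.
Proof.
rewrite [`|u|]/(L1_norm u) /L1_norm Lnorm1 fineK//.
apply: integrable_fin_num => //.
exact/integrable_abse/L1_integrable.
Qed.

(** A total function of f, so that operators given by a formula on representatives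
    can be defined before integrability is known; the value is meaningful when
    some class consists of functions almost everywhere equal to f. *)
Definition toL1 (f : T -> R) : L1 mu :=
  xget 0 [set v : L1 mu | \forall x \ae mu, v x = f x].

Lemma toL1E f : mu.-integrable [set: T] (EFin \o f) ->
  \forall x \ae mu, toL1 f x = f x.
Proof.
move=> /Lfun1_integrable fP; rewrite /toL1; case: xgetP => [v _ //|].
move=> /(_ (\pi_(L1 mu) (Lfun_Sub (@lexx _ _ 1%E) fP : L1fun mu))).
by case; exact: L1_pi_ae.
Qed.

Lemma toL1_unique f u : (\forall x \ae mu, u x = f x) -> toL1 f = u.
Proof.
move=> uf; rewrite /toL1; case: xgetP => [v _ vf|/(_ u)//].
by apply: L1_ext; apply: filterS2 uf vf => x -> ->.
Qed.

Lemma toL1_id u : toL1 u = u.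
Proof. by apply: toL1_unique; exact: aeW. Qed.

Lemma toL1_norm f : mu.-integrable [set: T] (EFin \o f) ->
  `|toL1 f|%:E = (\int[mu]_x `|f x|%:E)%E.
Proof.
move=> fi; rewrite L1_normE; apply: ae_eq_integral => //.
- apply/measurable_EFinP; apply: measurableT_comp => //; exact: L1_measurable.
- apply/measurable_EFinP; apply: measurableT_comp => //.
  by apply/measurable_EFinP; exact: measurable_int fi.
- by apply: filterS (toL1E fi) => x -> _.
Qed.

Lemma toL1B f g : mu.-integrable [set: T] (EFin \o f) ->
  mu.-integrable [set: T] (EFin \o g) ->
  toL1 (fun x => f x - g x) = toL1 f - toL1 g.
Proof.
move=> fi gi; apply: toL1_unique; have := L1_subE (toL1 f) (toL1 g).
by apply: filterS3 (toL1E fi) (toL1E gi) => x -> -> ->.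
Qed.

Lemma toL1D f g : mu.-integrable [set: T] (EFin \o f) ->
  mu.-integrable [set: T] (EFin \o g) ->
  toL1 (fun x => f x + g x) = toL1 f + toL1 g.
Proof.
move=> fi gi; apply: toL1_unique; have := L1_addE (toL1 f) (toL1 g).
by apply: filterS3 (toL1E fi) (toL1E gi) => x -> -> ->.
Qed.

Lemma toL1Z a f : mu.-integrable [set: T] (EFin \o f) ->
  toL1 (fun x => a * f x) = a *: toL1 f.
Proof.
move=> fi; apply: toL1_unique; have := L1_scaleE a (toL1 f).
by apply: filterS2 (toL1E fi) => x -> ->.
Qed.

(** Dominated convergence, as convergence in norm. *)
Lemma toL1_cvg (f_ : (T -> R)^nat) (f g : T -> R) :
  (forall n, measurable_fun [set: T] (f_ n)) ->
  measurable_fun [set: T] f ->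
  (\forall x \ae mu, f_ ^~ x @ \oo --> f x) ->
  mu.-integrable [set: T] (EFin \o g) ->
  (forall n, \forall x \ae mu, `|f_ n x| <= g x) ->
  toL1 (f_ n) @[n --> \oo] --> toL1 f.
Proof.
move=> mf_ mf f_f gi f_g.
have f_i n : mu.-integrable [set: T] (EFin \o f_ n).
  have [gm gfin] := integrableP _ _ _ gi.
  apply/integrableP; split; first exact/measurable_EFinP.
  apply: le_lt_trans gfin; apply: ae_ge0_le_integral => //.
  - by apply: measurableT_comp => //; exact/measurable_EFinP.
  - exact: measurableT_comp.
  - apply: filterS (f_g n) => x fg _ /=.
    by rewrite lee_fin (le_trans fg)// ler_norm.
have [||||fi cv _] := @dominated_convergence _ _ _ mu _ measurableT
   (fun n => EFin \o f_ n) (EFin \o f) (EFin \o g) _ _ _ gi.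
- by move=> n; exact/measurable_EFinP.
- exact/measurable_EFinP.
- by apply: filterS f_f => x fx _; apply: cvg_EFin => //; exact: nearW.
- apply: filterS (ae_foralln f_g) => x H n _ /=; rewrite lee_fin; exact: H.
apply/cvgrPdistC_le => /= e e0.
have e0' : (0 < e%:E)%E by rewrite lte_fin.
have /fine_cvgP[_ /cvgrPdist_le/(_ _ e0)] := cv; apply: filterS => n /=.
rewrite sub0r normrN ger0_norm; last first.
  by rewrite fine_ge0// integral_ge0.
have fBi := integrableB measurableT (f_i n) fi.
have nE : `|toL1 (f_ n) - toL1 f| = fine (\int[mu]_x `|(f_ n x - f x)%:E|)%E.
  by apply: EFin_inj; rewrite -toL1B// toL1_norm// fineK//;
    apply: integrable_fin_num => //; exact/integrable_abse.
by apply: le_trans; rewrite nE.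
Qed.

End L1_interface.

(** * A total family of weighted indicators *)

#[local] Instance ae_filterR (R : realType)
  (mu : {measure set (measurableTypeR R) -> \bar R}) :
  Filter (nbhs (almost_everywhere mu)).
Proof. exact: (ae_filter_ringOfSetsType mu). Qed.

Lemma cvg_indic_bigcup (T : Type) (R : realType) (F : (set T)^nat) (x : T) :
  nondecreasing_seq F -> \1_(F n) x @[n --> \oo] --> (\1_(\bigcup_i F i) x : R).
Proof.
move=> ndF; apply: cvg_near_cst.
have [[N _ FNx]|nF] := pselect ((\bigcup_i F i) x).
  near=> n; rewrite !indicE !mem_set//; first by exists N.
  have /subsetPset : (F N <= F n)%O by apply: ndF; near: n; exact: nbhs_infty_ge.
  exact.
apply: nearW => n; rewrite !indicE !memNset//.
by move=> Fnx; apply: nF; exists n.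
Unshelve. all: by end_near. Qed.

(** Totality of the functions 1_]a, b] e, phrased as an induction principle for a
    closed subspace G; w is the inverse of e on ]0, +oo[, which carries mu. *)
Section total.
Context (R : realType) (mu : {measure set (measurableTypeR R) -> \bar R}).
Variables w e : R -> R.
Hypothesis mw : measurable_fun [set: R] w.
Hypothesis me : measurable_fun [set: R] e.
Hypothesis w_ge0 : forall x, 0 <= w x.
Hypothesis e_ge0 : forall x, 0 <= e x.
Hypothesis weE : forall x : R, 0 < x -> w x * e x = 1.
Hypothesis mu_gt0 : \forall x \ae mu, 0 < x.
Hypothesis e_int : forall a b : R, 0 < a ->
  mu.-integrable [set: R] (fun x => (\1_(`]a, b]) x * e x)%:E).
Variable G : set (L1 mu).
Hypothesis GD : forall u v, G u -> G v -> G (u + v).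
Hypothesis GZ : forall c u, G u -> G (c *: u).
Hypothesis Gcvg : forall (u_ : nat -> L1 mu) u, (forall n, G (u_ n)) -> u_ @ \oo --> u -> G u.
Hypothesis Gitv : forall a b : R, 0 < a -> G (toL1 mu (fun x => \1_(`]a, b]) x * e x)).

Let e_intI (a b : R) (A : set (measurableTypeR R)) : 0 < a -> measurable A ->
  mu.-integrable [set: R] (fun x => (\1_(A `&` `]a, b]) x * e x)%:E).
Proof.
move=> a0 mA; apply: le_integrable (e_int b a0) => //.
  apply/measurable_EFinP/measurable_funM => //.
  by apply: measurable_indic; exact: measurableI.
move=> x _ /=; rewrite lee_fin !normrM ler_wpM2r// indicI !ger0_norm//.
by rewrite ler_piMl// indic_le1.
Qed.

(** For fixed a and b the Borel sets A with 1_(A & ]a, b]) e in G form a lambda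
    system: differences by linearity, increasing unions by dominated convergence.
    It contains the rays ]x, +oo[, a pi system that generates the Borel sets. *)
Let Gindic (a b : R) (A : set (measurableTypeR R)) : 0 < a -> measurable A ->
  G (toL1 mu (fun x => \1_(A `&` `]a, b]) x * e x)).
Proof.
move=> a0.
pose B := [set A : set (measurableTypeR R) | measurable A /\
  G (toL1 mu (fun x => \1_(A `&` `]a, b]) x * e x))].
suff sub : (measurable : set (set (measurableTypeR R))) `<=` B.
  by move=> mA; have [] := sub _ mA.
have -> : (measurable : set (set (measurableTypeR R))) = <<s @RGenOInfty.G R >>.
  exact: RGenOInfty.measurableE.
apply: lambda_system_subset => //.
- move=> _ _ [x ->] [y ->]; rewrite /RGenOInfty.G/=; exists (Num.max x y).
  rewrite predeqE => z /=; rewrite !in_itv/= !andbT gt_max.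
  by split => [[-> ->]//|/andP[]].
- split => //.
  + split => //; rewrite setTI; exact: Gitv.
  + move=> X Y YX [mX GX] [mY GY]; split; first exact: measurableD.
    rewrite (_ : (fun x => _) = (fun x => \1_(X `&` `]a, b]) x * e x - \1_(Y `&` `]a, b]) x * e x)).
      rewrite toL1B; [|exact: e_intI..].
      by rewrite -scaleN1r; apply: GD => //; exact: GZ.
    apply/funext => x; rewrite -mulrBl; congr (_ * _); rewrite !indicI /= -mulrBl.
    congr (_ * _); rewrite !indicE. rewrite -/(~` Y) in_setC.
    have : x \in Y -> x \in X by rewrite !inE; exact: YX.
    case: (x \in X); case: (x \in Y) => //=.
    + by rewrite subrr mulr0.
    + by rewrite subr0 mulr1.
    + by move=> /(_ isT).
    + by rewrite subrr mul0r.
  + move=> F ndF FB; have mF i : measurable (F i) by have [] := FB i.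
    split; first exact: bigcupT_measurable.
    have GF n : G (toL1 mu (fun x => \1_(F n `&` `]a, b]) x * e x)).
      by have [] := FB n.
    apply: (Gcvg GF).
    apply: (@toL1_cvg _ _ _ mu (fun n x => \1_(F n `&` `]a, b]) x * e x)
      (fun x => \1_((\bigcup_i F i) `&` `]a, b]) x * e x)
      (fun x => \1_(`]a, b]) x * e x)).
    * move=> n; apply: measurable_funM => //; apply: measurable_indic; exact: measurableI.
    * apply: measurable_funM => //; apply: measurable_indic; apply: measurableI => //.
      exact: bigcupT_measurable.
    * apply: aeW => x; apply: cvgM; last exact: cvg_cst.
      rewrite indicI /=; under eq_fun do rewrite indicI /=.
      by apply: cvgM; [exact: cvg_indic_bigcup|exact: cvg_cst].
    * exact: e_int.
    * move=> n; apply: aeW => x.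
      rewrite normrM (ger0_norm (e_ge0 x)) ler_wpM2r// indicI ger0_norm//=.
      by rewrite ler_piMl// indic_le1.
- move=> _ [x ->]; split => //.
  rewrite (_ : _ `&` _ = `]Num.max x a, b]%classic); last first.
    rewrite predeqE => z /=; rewrite !in_itv/= andbT gt_max.
    by split => [[-> /andP[-> ->]]//|/andP[/andP[-> ->] ->]].
  by apply: Gitv; rewrite lt_max a0 orbT.
Qed.

Import HBNNSimple.

Let Gsum (I : eqType) (s : seq I) (F : I -> R -> R) :
  (forall i, i \in s -> mu.-integrable [set: R] (EFin \o F i) /\ G (toL1 mu (F i))) ->
  G 0 ->
  mu.-integrable [set: R] (EFin \o (fun x => \sum_(i <- s) F i x)) /\
  G (toL1 mu (fun x => \sum_(i <- s) F i x)).
Proof.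
move=> + G0; elim: s => [_|i s IH H].
  split.
    under eq_fun do rewrite big_nil.
    exact: integrable0.
  rewrite (_ : toL1 _ _ = 0)//.
  apply: toL1_unique.
  have := L1_scaleE 0 (0 : L1 mu); rewrite scale0r; apply: filterS => x ->.
  by rewrite mul0r big_nil.
have [|si Gs] := IH.
  by move=> j js; apply: H; rewrite inE js orbT.
have [ii Gi] : mu.-integrable [set: R] (EFin \o F i) /\ G (toL1 mu (F i)).
  by apply: H; rewrite inE eqxx.
have -> : (fun x => \sum_(j <- i :: s) F j x) = (fun x => F i x + \sum_(j <- s) F j x).
  by apply/funext => x; rewrite big_cons.
split; first exact: (integrableD measurableT ii si).
by rewrite toL1D//; exact: GD.
Qed.

(** For nonnegative f, the product w f is the increasing limit of simple functions
    g_n. Then g_n 1_]1/(n+1), n+1] e is a linear combination of functions treated by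
    the previous steps, is at most w f e = f, and tends to f. *)
Let Gge0 (f : R -> R) : mu.-integrable [set: R] (EFin \o f) ->
  (forall x, 0 <= f x) -> G (toL1 mu f).
Proof.
move=> fi f0; have mf : measurable_fun [set: R] f.
  by apply/measurable_EFinP; exact: measurable_int fi.
pose h x := f x * w x.
have mh : measurable_fun [set: measurableTypeR R] (EFin \o h).
  exact/measurable_EFinP/measurable_funM.
have h0 x : (0 <= (EFin \o h) x)%E by rewrite lee_fin mulr_ge0.
pose g_ := nnsfun_approx measurableT mh.
pose I n := `](n.+1%:R^-1 : R), n.+1%:R]%classic.
have Ipos n x : I n x -> 0 < x.
  by rewrite /I/= in_itv/= => /andP[+ _]; apply: lt_trans; rewrite invr_gt0 ltr0n.
have gE n x : \sum_(k <- finmap.enum_fset (fset_set (range (g_ n))))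
     k * (\1_((g_ n @^-1` [set k]) `&` I n) x * e x) = g_ n x * \1_(I n) x * e x.
  rewrite [in RHS]fimfunE fsbig_finite//= 2!big_distrl/=; apply: eq_bigr => k _.
  by rewrite indicI /= !mulrA.
apply: (@Gcvg (fun n => toL1 mu (fun x => g_ n x * \1_(I n) x * e x))).
  move=> n; rewrite -(funext (gE n)).
  apply: (proj2 (Gsum _ _)) => [k _|]; last first.
    have := Gitv 1 ltr01; move=> /(GZ 0); rewrite scale0r; exact.
  have Ii : mu.-integrable [set: R]
     (EFin \o (fun x => \1_((g_ n @^-1` [set k]) `&` I n) x * e x)).
    apply: e_intI; first by rewrite invr_gt0 ltr0n.
    exact: (measurable_funPTI (g_ n) (measurable_set1 k)).
  split; first exact: (integrableZl measurableT k Ii).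
  rewrite toL1Z//; apply: GZ; apply: Gindic; first by rewrite invr_gt0 ltr0n.
  exact: (measurable_funPTI (g_ n) (measurable_set1 k)).
apply: (@toL1_cvg _ _ _ mu (fun n x => g_ n x * \1_(I n) x * e x) f f).
- move=> n; apply: measurable_funM => //; apply: measurable_funM.
    exact: measurable_funP.
  by apply: measurable_indic; exact: measurable_itv.
- exact: mf.
- move: mu_gt0; apply: filterS => x x0.
  have -> : f x = h x * 1 * e x by rewrite mulr1 -mulrA weE// mulr1.
  apply: cvgM; last exact: cvg_cst.
  apply: cvgM.
    have := cvg_nnsfun_approx measurableT mh (fun x _ => h0 x) (Logic.I : [set: R] x).
    by move/fine_cvgP => [_].
  apply: cvg_near_cst; near=> n; rewrite indicE mem_set// /I/= in_itv/=.
  apply/andP; split; near: n; last first.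
    by have := nbhs_infty_ger x; apply: filterS => n /le_trans; apply; rewrite ler_nat.
  exact: (near_infty_natSinv_lt (PosNum x0)).
- exact: fi.
- move=> n; apply: aeW => x.
  have [Ix|nIx] := pselect (I n x); last first.
    by rewrite indicE memNset// mulr0 mul0r normr0.
  rewrite indicE mem_set// mulr1 ger0_norm ?mulr_ge0//.
  rewrite -[leRHS]mulr1 -(weE (Ipos _ _ Ix)) mulrA ler_wpM2r//.
  rewrite -lee_fin /g_ nnsfun_approxE.
  exact: (le_approx n (fun x _ => h0 x)).
Unshelve. all: by end_near. Qed.

Lemma L1_indic_itv_total u : G u.
Proof.
have ui := L1_integrable u.
have mu_ := L1_measurable u.
have ip : mu.-integrable [set: R] (EFin \o (u : R -> R)^\+) by exact: integrable_funrpos.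
have ineg : mu.-integrable [set: R] (EFin \o (u : R -> R)^\-) by exact: integrable_funrneg.
rewrite -(toL1_id u) -[X in toL1 mu X]funrposBneg.
rewrite (toL1B ip ineg) -scaleN1r; apply: GD; last apply: GZ.
  exact: Gge0.
exact: Gge0.
Qed.
End total.

(** * The clock *)

Definition clock (R : realType) (r : R -> R) (x : R) : R :=
  if 1 <= x then fine (travel_time r 1 x) else - fine (travel_time r x 1).

Definition clockV (R : realType) (r : R -> R) (s : R) : R :=
  get [set x : R | 0 < x /\ clock r x = s].

Section flow.
Local Open Scope quotient_scope.
Context (R : realType) (r : R -> R).
Hypothesis r_cont : {within `]0, +oo[, continuous r}.
Hypothesis r_gt0 : forall x : R, 0 < x -> 0 < r x.

Lemma continuous_inv_rate (x : R) : 0 < x -> {for x, continuous (fun z => (r z)^-1)}.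
Proof.
move=> x0; apply: cvgV; first by rewrite gt_eqF// r_gt0.
move: r_cont; rewrite continuous_open_subspace//.
by apply; rewrite inE/= in_itv/= x0.
Qed.

Lemma continuous_within_inv_rate (a b : R) : 0 < a ->
  {within `[a, b], continuous (fun z => (r z)^-1)}.
Proof.
move=> a0; apply: continuous_in_subspaceT => x.
rewrite inE/= in_itv/= => /andP[ax _].
exact: continuous_inv_rate (lt_le_trans a0 ax).
Qed.

Lemma measurable_inv_rate : measurable_fun (`]0, +oo[ : set (measurableTypeR R)) (fun z => (r z)^-1).
Proof.
apply: open_continuous_measurable_fun; first exact: interval_open.
by move=> x; rewrite inE/= in_itv/= andbT; exact: continuous_inv_rate.
Qed.

Lemma inv_rate_integrable (a b : R) : 0 < a ->
  (@lebesgue_measure R).-integrable `[a, b] (fun z => (r z)^-1%:E).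
Proof.
move=> a0; apply: continuous_compact_integrable; first exact: segment_compact.
exact: continuous_within_inv_rate.
Qed.

Lemma travel_time_fin (a b : R) : 0 < a -> travel_time r a b \is a fin_num.
Proof. by move=> a0; exact: integrable_fin_num (inv_rate_integrable b a0). Qed.

Lemma travel_time_add (a b c : R) : 0 < a -> a <= b -> b <= c ->
  (travel_time r a c = travel_time r a b + travel_time r b c)%E.
Proof.
move=> a0 ab bc; have b0 := lt_le_trans a0 ab.
have minv (i : interval R) : [set` i] `<=` `]0, +oo[ ->
    measurable_fun ([set` i] : set (measurableTypeR R)) (fun z => (r z)^-1%:E).
  by move=> iS; apply/measurable_EFinP; exact: measurable_funS measurable_inv_rate.
have acE : `[a, c]%classic = `[a, b]%classic `|` `]b, c]%classic.
  rewrite predeqE => z /=; rewrite !in_itv/=; split.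
    by move=> /andP[az zc]; case: (leP z b) => zb; [left|right]; apply/andP.
  move=> [/andP[az zb]|/andP[bz zc]]; apply/andP; split => //.
    exact: le_trans bc.
  exact: le_trans (ltW bz).
rewrite /travel_time acE.
rewrite ge0_integral_setU//=.
- rewrite [X in (_ + X)%E]integral_itv_obnd_cbnd//.
  apply: minv => z/=; rewrite !in_itv/= andbT => /andP[bz _].
  exact: lt_trans bz.
- rewrite -acE; apply: minv => z/=.
  rewrite !in_itv/= andbT => /andP[az _]; exact: lt_le_trans az.
- move=> z zac; rewrite lee_fin invr_ge0 ltW// r_gt0//.
  by move: zac; rewrite !in_itv/= => -[/andP[/(lt_le_trans a0)]|/andP[/(lt_trans b0)]].
- apply/disj_set2P; rewrite -subset0 => z/=; rewrite !in_itv/=.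
  by move=> [/andP[_ zb] /andP[bz _]]; move: (lt_le_trans bz zb); rewrite ltxx.
Qed.

Lemma travel_time_refl (a : R) : travel_time r a a = 0%E.
Proof. by rewrite /travel_time set_itv1 integral_set1. Qed.

Lemma travel_timeE (a b : R) : 0 < a -> a <= b ->
  (travel_time r a b = (clock r b - clock r a)%:E)%E.
Proof.
move=> a0 ab; have b0 := lt_le_trans a0 ab.
rewrite /clock; have [b1|b1] := leP 1 b; have [a1|a1] := leP 1 a.
- rewrite EFinB !fineK ?travel_time_fin//.
  by rewrite (travel_time_add _ a1 ab)// addeAC subee ?travel_time_fin// add0e.
- rewrite opprK EFinD !fineK ?travel_time_fin//.
  by rewrite (travel_time_add a0 (ltW a1) b1)// addeC.
- by move: (le_lt_trans ab b1); rewrite ltNge a1.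
- rewrite EFinD !EFinN oppeK !fineK ?travel_time_fin//.
  rewrite (travel_time_add a0 ab (ltW b1)) addeC -addeA subee ?adde0//.
  exact: travel_time_fin.
Qed.

(** Near x the clock is, up to a constant, the integral of 1/r from x/2, to which
    the fundamental theorem of calculus applies. *)
Lemma is_derive_clock (x : R) : 0 < x -> is_derive x 1 (clock r) (r x)^-1.
Proof.
move=> x0; have x20 : 0 < x / 2 by rewrite divr_gt0.
have x2x : x / 2 < x by rewrite ltr_pdivrMr// ltr_pMr// ltr1n.
have xx1 : x < x + 1 by rewrite ltrDl.
have dF : is_derive x 1 (fun z => fine (travel_time r (x / 2) z)) (r x)^-1.
  have [dF F'] := continuous_FTC1_closed xx1 (inv_rate_integrable (x + 1) x20) x2x
    (continuous_inv_rate x0).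
  by rewrite derive1E in F'; exact: (DeriveDef dF F').
have dF' : is_derive x 1
    ((fun z => fine (travel_time r (x / 2) z)) + cst (clock r (x / 2))) (r x)^-1.
  by rewrite -[X in is_derive _ _ _ X]addr0; apply: is_deriveD.
apply: near_eq_is_derive dF'.
near=> z.
have zx2 : x / 2 <= z by apply: ltW; near: z; exact: lt_nbhsr.
by rewrite fctE travel_timeE//= subrK.
Unshelve. all: by end_near. Qed.

Lemma continuous_clock (x : R) : 0 < x -> {for x, continuous (clock r)}.
Proof.
by move=> /is_derive_clock[d _]; exact/differentiable_continuous/derivable1_diffP.
Qed.

Lemma clock_lt (a b : R) : 0 < a -> a < b -> clock r a < clock r b.
Proof.
move=> a0 ab.
have [||c] := @MVT _ (clock r) (fun z => (r z)^-1) a b ab.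
- by move=> z; rewrite in_itv/= => /andP[ax _]; apply: is_derive_clock; exact: lt_trans ax.
- apply: continuous_in_subspaceT => z.
  rewrite inE/= in_itv/= => /andP[ax _]; apply: continuous_clock; exact: lt_le_trans ax.
rewrite in_itv/= => /andP[ac _] E; rewrite -subr_gt0 E mulr_gt0 ?subr_gt0// invr_gt0.
by apply: r_gt0; exact: lt_trans ac.
Qed.

Hypothesis r_0 :
  (\int[lebesgue_measure]_(tau in `]0%R, 1%R]) ((r tau)^-1)%:E = +oo)%E.
Hypothesis r_oo :
  (\int[lebesgue_measure]_(tau in `[1%R, +oo[) ((r tau)^-1)%:E = +oo)%E.

Lemma clock1 : clock r 1 = 0.
Proof. by rewrite /clock lexx travel_time_refl. Qed.

(** Used to contradict the divergence of the integrals of 1/r when the clock is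
    bounded on one side. *)
Lemma integral_bigcup_le (F : (set (measurableTypeR R))^nat) (f : R -> R) (M : R) :
  nondecreasing_seq F -> (forall n, measurable (F n)) ->
  (forall n, measurable_fun (F n) f) -> (forall n x, F n x -> 0 <= f x) ->
  (forall n, \int[lebesgue_measure]_(x in F n) (f x)%:E <= M%:E)%E ->
  (\int[lebesgue_measure]_(x in \bigcup_n F n) (f x)%:E <= M%:E)%E.
Proof.
move=> ndF mF mf f0 FM.
have cv : (\int[lebesgue_measure]_(x in F n) (f x)%:E @[n --> \oo] -->
    \int[lebesgue_measure]_(x in \bigcup_n F n) (f x)%:E)%E.
  apply: ge0_nondecreasing_set_cvg_integral => //.
  by move=> n; exact/measurable_EFinP.
rewrite -(cvg_lim _ cv)//; apply: lime_le; first exact: cvgP cv.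
exact: nearW.
Qed.

Lemma measurable_inv_rate_itv (i : interval R) : [set` i] `<=` `]0, +oo[ ->
  measurable_fun ([set` i] : set (measurableTypeR R)) (fun z => (r z)^-1).
Proof. by move=> iS; exact: measurable_funS measurable_inv_rate. Qed.

Lemma clock_cofinal (M : R) : exists2 x, 1 <= x & M < clock r x.
Proof.
apply: contrapT => nM.
have hM x : 1 <= x -> clock r x <= M.
  by move=> x1; rewrite leNgt; apply/negP => Mx; apply: nM; exists x.
pose F n : set (measurableTypeR R) := `[1, n.+1%:R]%classic.
have FU : \bigcup_n F n = `[1, +oo[%classic.
  rewrite predeqE => x /=; split => [[n _]|]; rewrite /F/= !in_itv/= ?andbT.
    by case/andP.
  move=> x1; have [n _ /(_ n (leqnn n)) nx] := nbhs_infty_ger x.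
  by exists n => //; rewrite /F/= in_itv/= x1 (le_trans nx)// ler_nat.
suff : (\int[lebesgue_measure]_(tau in \bigcup_n F n) ((r tau)^-1)%:E <= M%:E)%E.
  by rewrite FU r_oo leye_eq.
have Fpos n : F n `<=` `]0, +oo[.
  by move=> z; rewrite /F/= !in_itv/= andbT => /andP[z1 _]; exact: lt_le_trans z1.
apply: integral_bigcup_le => //.
- move=> m n mn; apply/subsetPset => z; rewrite /F/= !in_itv/= => /andP[-> /le_trans]; apply.
  by rewrite ler_nat ltnS.
- by move=> n; exact: measurable_itv.
- by move=> n; apply: measurable_inv_rate_itv; exact: Fpos.
- move=> n x /Fpos; rewrite /= in_itv/= andbT => x0.
  by rewrite invr_ge0 ltW// r_gt0.
- move=> n; have n1 : 1 <= n.+1%:R :> R by rewrite ler1n.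
  have := travel_timeE ltr01 n1; rewrite clock1 subr0 /travel_time => ->.
  by rewrite lee_fin hM.
Qed.

Lemma clock_coinitial (M : R) : exists2 x, 0 < x <= 1 & clock r x < M.
Proof.
apply: contrapT => nM.
have hM x : 0 < x -> x <= 1 -> M <= clock r x.
  by move=> x0 x1; rewrite leNgt; apply/negP => Mx; apply: nM; exists x => //; rewrite x0.
pose F n : set (measurableTypeR R) := `[n.+1%:R^-1, 1]%classic.
have n0 n : 0 < n.+1%:R^-1 :> R by rewrite invr_gt0 ltr0n.
have FU : \bigcup_n F n = `]0, 1]%classic.
  rewrite predeqE => x /=; split => [[n _]|]; rewrite /F/= !in_itv/=.
    by move=> /andP[nx ->]; rewrite (lt_le_trans (n0 n) nx).
  move=> /andP[x0 x1].
  have [n _ /(_ n (leqnn n)) nx] := near_infty_natSinv_lt (PosNum x0).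
  by exists n => //; rewrite /F/= in_itv/= x1 andbT ltW.
suff : (\int[lebesgue_measure]_(tau in \bigcup_n F n) ((r tau)^-1)%:E <= (- M)%:E)%E.
  by rewrite FU r_0 leye_eq.
have Fpos n : F n `<=` `]0, +oo[.
  by move=> z; rewrite /F/= !in_itv/= andbT => /andP[z1 _]; exact: lt_le_trans z1.
apply: integral_bigcup_le => //.
- move=> m n mn; apply/subsetPset => z; rewrite /F/= !in_itv/= => /andP[mz ->]; rewrite andbT.
  by apply: le_trans mz; rewrite lef_pV2 ?posrE ?ltr0n// ler_nat ltnS.
- by move=> n; exact: measurable_itv.
- by move=> n; apply: measurable_inv_rate_itv; exact: Fpos.
- move=> n x /Fpos; rewrite /= in_itv/= andbT => x0.
  by rewrite invr_ge0 ltW// r_gt0.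
- move=> n; have n1 : n.+1%:R^-1 <= 1 :> R by rewrite invf_le1 ?ler1n// ltr0n.
  have := travel_timeE (n0 n) n1; rewrite clock1 sub0r /travel_time => ->.
  by rewrite lee_fin lerN2 hM.
Qed.

Lemma clock_surj (s : R) : exists x, 0 < x /\ clock r x = s.
Proof.
have [b b1 sb] := clock_cofinal s; have [a /andP[a0 a1] ast] := clock_coinitial s.
have ab := le_trans a1 b1.
have cab : {within `[a, b], continuous (clock r)}.
  apply: continuous_in_subspaceT => x.
  by rewrite inE/= in_itv/= => /andP[ax _]; apply: continuous_clock; exact: lt_le_trans ax.
have [|c cab' cE] := IVT ab cab (v := s).
  by rewrite ge_min le_max (ltW sb) (ltW ast) orbT.
exists c; split => //; move: cab'; rewrite in_itv/= => /andP[ac _].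
exact: lt_le_trans ac.
Qed.

Lemma clockV_spec (s : R) : 0 < clockV r s /\ clock r (clockV r s) = s.
Proof. exact: (getPex (clock_surj s)). Qed.

Lemma clockV_gt0 (s : R) : 0 < clockV r s. Proof. by case: (clockV_spec s). Qed.
#[local] Hint Resolve clockV_gt0 : core.

Lemma clockVK (s : R) : clock r (clockV r s) = s. Proof. by case: (clockV_spec s). Qed.

Lemma clock_ltE (a b : R) : 0 < a -> 0 < b -> (clock r a < clock r b) = (a < b).
Proof.
move=> a0 b0; apply/idP/idP; last exact: clock_lt.
apply: contraTT; rewrite -!leNgt le_eqVlt => /predU1P[->//|/(clock_lt b0)].
exact: ltW.
Qed.

Lemma clock_leE (a b : R) : 0 < a -> 0 < b -> (clock r a <= clock r b) = (a <= b).
Proof. by move=> a0 b0; rewrite !leNgt clock_ltE. Qed.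

Lemma clockK (x : R) : 0 < x -> clockV r (clock r x) = x.
Proof.
move=> x0; have k0 := clockV_gt0 (clock r x).
by apply/eqP; rewrite eq_le -(clock_leE k0 x0) -(clock_leE x0 k0) clockVK lexx.
Qed.

Lemma clockV_leE (s t : R) : (clockV r s <= clockV r t) = (s <= t).
Proof. by rewrite -clock_leE ?clockV_gt0// !clockVK. Qed.

Lemma clockV_lt_clock (s x : R) : 0 < x -> (clockV r s < x) = (s < clock r x).
Proof. by move=> x0; rewrite -[in RHS](clockVK s) clock_ltE ?clockV_gt0. Qed.

Lemma clock_le_clockV (x s : R) : 0 < x -> (x <= clockV r s) = (clock r x <= s).
Proof. by move=> x0; rewrite -[in RHS](clockVK s) clock_leE ?clockV_gt0. Qed.

Lemma clockV_le_clock (s x : R) : 0 < x -> (clockV r s <= x) = (s <= clock r x).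
Proof. by move=> x0; rewrite -[in RHS](clockVK s) clock_leE ?clockV_gt0. Qed.

Lemma clock_lt_clockV (x s : R) : 0 < x -> (x < clockV r s) = (clock r x < s).
Proof. by move=> x0; rewrite -[in RHS](clockVK s) clock_ltE ?clockV_gt0. Qed.

Lemma measurable_clockV : measurable_fun [set: measurableTypeR R] (clockV r).
Proof. by apply: nondecreasing_measurable => // s t st; rewrite clockV_leE. Qed.

Lemma is_derive_clockV (s : R) : is_derive s 1 (clockV r) (r (clockV r s)).
Proof.
have k0 := clockV_gt0 s.
have := @is_derive_inverse R (clock r) (clockV r) (r (clockV r s))^-1 (clockV r s).
rewrite clockVK invrK; apply.
- near=> z; apply: clockK; near: z; exact: lt_nbhsr.
- near=> z; apply: continuous_clock; near: z; exact: lt_nbhsr.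
- exact: is_derive_clock.
- by rewrite invr_eq0 gt_eqF// r_gt0.
Unshelve. all: by end_near. Qed.

(** * The characteristics in terms of the clock *)

Lemma charXE (y t : R) : 0 < y -> 0 <= t -> charX r y t = clockV r (clock r y - t).
Proof.
move=> y0 t0; rewrite /charX.
have ky : clockV r (clock r y - t) <= y.
  by rewrite -clock_leE ?clockV_gt0// clockVK lerBlDr lerDl.
have : [set x : R | 0 < x <= y /\ travel_time r x y = t%:E] (clockV r (clock r y - t)).
  split; first by rewrite clockV_gt0.
  by rewrite travel_timeE ?clockV_gt0// clockVK opprB addrC subrK.
move=> /getI[/andP[]].
move: (get _) => x x0 xy; rewrite travel_timeE// => -[tE].
by rewrite -tE opprB addrC subrK clockK.
Qed.

Lemma charyE (x t : R) : 0 < x -> 0 <= t -> chary r x t = clockV r (clock r x + t).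
Proof.
move=> x0 t0; rewrite /chary.
have kx : x <= clockV r (clock r x + t).
  by rewrite -clock_leE ?clockV_gt0// clockVK lerDl.
have : [set y : R | x <= y /\ travel_time r x y = t%:E] (clockV r (clock r x + t)).
  split => //.
  by rewrite travel_timeE ?clockV_gt0// clockVK addrAC subrr add0r.
move=> /getI[].
move: (get _) => y xy; rewrite travel_timeE// => -[tE].
by rewrite -tE addrC subrK clockK// (lt_le_trans x0).
Qed.

Lemma is_derive_charX (y t : R) : 0 < y -> 0 <= t ->
  is_derive y 1 (fun z => charX r z t) (r (charX r y t) / r y).
Proof.
move=> y0 t0.
have D1 : is_derive y 1 (clockV r \o (clock r + cst (- t))) (r (charX r y t) / r y).
  apply: is_derive1_comp.
    by rewrite charXE//; exact: is_derive_clockV.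
  by rewrite -[X in is_derive _ _ _ X]addr0; apply: is_deriveD; exact: is_derive_clock.
apply: near_eq_is_derive D1; near=> z.
by rewrite charXE//; near: z; exact: lt_nbhsr.
Unshelve. all: by end_near. Qed.

(** * Invariance of dx / r(x) under the flow *)

Local Notation mR := (measurableTypeR R).
Local Notation pos := (`]0, +oo[%classic : set mR).
Local Notation k := (clockV r).
Local Notation leb := (@lebesgue_measure R).

(** Nothing is known about r on ]-oo, 0]. The cut-offs below vanish there, which makes
    them Borel functions on the whole line; [pace] is the density of the measure
    invariant under the flow. *)
Definition rate : R -> R := r \_ pos.
Definition pace : R -> R := (fun x => (r x)^-1) \_ pos.
Definition clock0 : mR -> mR := clock r \_ pos.

Let patch_pos (f : R -> R) (x : R) : 0 < x -> (f \_ pos) x = f x.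
Proof. by move=> x0; rewrite patchE mem_set//= in_itv/= x0. Qed.

Let patch_npos (f : R -> R) (x : R) : x <= 0 -> (f \_ pos) x = 0.
Proof. by move=> x0; rewrite patchE memNset//= in_itv/= andbT; apply/negP; rewrite -leNgt. Qed.

Lemma rateE (x : R) : 0 < x -> rate x = r x. Proof. exact: patch_pos. Qed.
Lemma paceE (x : R) : 0 < x -> pace x = (r x)^-1. Proof. exact: patch_pos. Qed.
Lemma clock0E (x : R) : 0 < x -> clock0 x = clock r x. Proof. exact: patch_pos. Qed.
Lemma pace_npos (x : R) : x <= 0 -> pace x = 0. Proof. exact: patch_npos. Qed.

Lemma rate_ge0 (x : R) : 0 <= rate x.
Proof.
by have [x0|x0] := ltP 0 x; [rewrite rateE// ltW// r_gt0|rewrite /rate patch_npos].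
Qed.

Lemma pace_ge0 (x : R) : 0 <= pace x.
Proof.
by have [x0|x0] := ltP 0 x; [rewrite paceE// invr_ge0 ltW// r_gt0|rewrite pace_npos].
Qed.

Lemma rate_pace (x : R) : 0 < x -> rate x * pace x = 1.
Proof. by move=> x0; rewrite rateE// paceE// divff// gt_eqF// r_gt0. Qed.

Let measurable_patch (f : R -> R) : (forall x : R, 0 < x -> {for x, continuous f}) ->
  measurable_fun [set: mR] (f \_ pos).
Proof.
move=> fc.
suff mf : measurable_fun (`]0, +oo[ : set (measurableTypeR R)) f.
  have mpos : measurable pos by exact: measurable_itv.
  exact: (proj1 (measurable_restrictT f mpos) mf).
apply: open_continuous_measurable_fun; first exact: interval_open.
by move=> x; rewrite inE/= in_itv/= andbT; exact: fc.
Qed.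

Lemma measurable_rate : measurable_fun [set: mR] rate.
Proof.
apply: measurable_patch => x x0; move: r_cont; rewrite continuous_open_subspace//.
by apply; rewrite inE/= in_itv/= x0.
Qed.

Lemma measurable_pace : measurable_fun [set: mR] pace.
Proof. apply: measurable_patch => x; exact: (continuous_inv_rate). Qed.

Lemma measurable_clock0 : measurable_fun [set: mR] clock0.
Proof. by apply: measurable_patch => x; exact: (continuous_clock). Qed.

Let mk : measurable_fun [set: mR] (k : mR -> mR). Proof. exact: measurable_clockV. Qed.

(** Lebesgue measure is the image under the clock of the measure with density
    [pace]: the latter gives ]k a, k b] the travel time from k a to k b, which is
    b - a, and these values on intervals characterize the Lebesgue measure. *)
Lemma integral_clockV (g : R -> \bar R) :
  measurable_fun [set: mR] g -> (forall x, 0 <= g x)%E ->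
  (\int[leb]_s g (k s) = \int[leb]_x (g x * (pace x)%:E))%E.
Proof.
move=> mg g0.
pose nu := density_measure leb measurable_pace pace_ge0.
pose hm : {mfun mR >-> mR} := HB.pack clock0 (isMeasurableFun.Build _ _ _ _ _ measurable_clock0).
have mgk : measurable_fun [set: mR] (g \o k) by exact: measurableT_comp.
transitivity (\int[pushforward nu hm]_s g (k s))%E.
  apply: eq_measure_integral => A mA _.
  apply: lebesgue_measure_unique => // _ [[a b] _ <-].
  transitivity (nu (clock0 @^-1` `]a, b])); last by [].
  transitivity (\int[leb]_(x in `]k a, k b]) ((r x)^-1)%:E)%E.
    have kapos : (`]k a, k b]%classic : set mR) `<=` `]0, +oo[.
      move=> x /=; rewrite !in_itv/= andbT => /andP[+ _].
      by apply: lt_trans; exact: clockV_gt0.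
    have [ab|ba] := ltP a b; last first.
      rewrite set_itv_ge ?measure0 -?leNgt// ?bnd_simp//.
      rewrite set_itv_ge ?integral_set0// bnd_simp -leNgt.
      by rewrite clockV_leE.
    rewrite lebesgue_measure_itv/= lte_fin ab.
    rewrite integral_itv_obnd_cbnd; last first.
      by apply/measurable_EFinP; exact: measurable_inv_rate_itv kapos.
    have kab : k a <= k b by rewrite clockV_leE ltW.
    have := travel_timeE (clockV_gt0 a) kab; rewrite /travel_time => ->.
    by rewrite !clockVK -EFinB.
  rewrite /nu /density_measure [LHS]integral_mkcond [RHS]integral_mkcond.
  apply: eq_integral => x _; rewrite !patchE.
  have [x0|x0] := ltP 0 x; last first.
    rewrite pace_npos// [X in _ = X](_ : _ = 0%E); last by case: ifP.
    rewrite memNset//= in_itv/=; apply/negP; rewrite negb_and -leNgt.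
    by rewrite (le_trans x0)// ltW// clockV_gt0.
  rewrite paceE// (_ : (x \in _) = (x \in clock0 @^-1` `]a, b]%classic))//.
  apply/idP/idP; rewrite !inE/= !in_itv/= clock0E//;
    by rewrite clockV_lt_clock// clock_le_clockV.
rewrite (ge0_integral_pushforward measurable_clock0)//.
rewrite preimage_setT.
have nuE (A : set mR) : measurable A -> nu A = (\int[leb]_(x in A) (pace x)%:E)%E by [].
rewrite (ge0_integral_density measurable_pace pace_ge0 nuE); last 2 first.
- by apply: (measurableT_comp mgk); exact: measurable_clock0.
- by move=> x; exact: g0.
apply: eq_integral => x _ /=; have [x0|x0] := ltP 0 x.
  by rewrite clock0E// clockK.
by rewrite pace_npos// !mule0.
Qed.

Variable alpha : R.

(** The weight y(x, t)^alpha; for t = 0 it is the density of the measure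
    x^alpha dx. *)
Definition weight (t : R) : R -> R := (fun x => k (clock r x + t) `^ alpha) \_ pos.

(** U0(t) cut off on ]-oo, 0], and written with the clock, so that it is a Borel
    function of y and makes sense for all real t. *)
Definition transport (t : R) (f : R -> R) (y : R) : R :=
  rate (k (clock0 y - t)) * f (k (clock0 y - t)) * pace y.

Lemma weightE (t x : R) : 0 < x -> weight t x = k (clock r x + t) `^ alpha.
Proof. exact: patch_pos. Qed.

Lemma weight_npos (t x : R) : x <= 0 -> weight t x = 0.
Proof. exact: patch_npos. Qed.

Lemma weight_ge0 (t x : R) : 0 <= weight t x.
Proof. by have [x0|x0] := ltP 0 x; [rewrite weightE// powR_ge0|rewrite weight_npos]. Qed.

Lemma weight0 (x : R) : 0 < x -> weight 0 x = x `^ alpha.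
Proof. by move=> x0; rewrite weightE// addr0 clockK. Qed.

Lemma measurable_shift_clock0 (t : R) : measurable_fun [set: mR] (fun x : mR => k (clock0 x + t) : mR).
Proof.
apply: measurableT_comp; first exact: mk.
by apply: measurable_funD => //; exact: measurable_clock0.
Qed.

Lemma measurable_weight (t : R) : measurable_fun [set: mR] (weight t).
Proof.
have -> : weight t = (fun x => k (clock0 x + t) `^ alpha) \_ pos.
  apply/funext => x; have [x0|x0] := ltP 0 x; last by rewrite weight_npos// patch_npos.
  by rewrite weightE// patch_pos// clock0E.
have mpos : measurable pos by exact: measurable_itv.
apply: (proj1 (measurable_restrictT _ mpos)); apply: measurable_funTS.
apply: (measurableT_comp (measurable_powR alpha)).
exact: measurable_shift_clock0.
Qed.

Lemma measurable_transport t (f : R -> R) : measurable_fun [set: mR] f ->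
  measurable_fun [set: mR] (transport t f).
Proof.
move=> mf; apply: measurable_funM; last exact: measurable_pace.
by apply: measurable_funM; apply: measurableT_comp;
  [exact: measurable_rate|exact: measurable_shift_clock0|
   exact: mf|exact: measurable_shift_clock0].
Qed.

Lemma transportE (t y : R) (f : R -> R) : 0 <= t -> 0 < y -> transport t f y = U0 r t f y.
Proof.
move=> t0 y0; rewrite /transport /U0 clock0E// paceE// rateE//.
by rewrite charXE.
Qed.

Lemma transport_npos (t y : R) (f : R -> R) : y <= 0 -> transport t f y = 0.
Proof. by move=> y0; rewrite /transport pace_npos// mulr0. Qed.

Lemma integral_xpow (g : R -> \bar R) : measurable_fun [set: mR] g -> (forall x, 0 <= g x)%E ->
  (\int[xpow_measure alpha]_x g x = \int[leb]_x (g x * (weight 0 x)%:E))%E.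
Proof.
move=> mg g0; apply: ge0_integral_density => //.
- exact: measurable_weight.
- exact: weight_ge0.
move=> A mA; rewrite /= /xpow_measure integral_mkcondr; apply: eq_integral => x _.
rewrite patchE; have [x0|x0] := ltP 0 x; first by rewrite mem_set ?weight0//= in_itv/= x0.
by rewrite memNset ?weight_npos//= in_itv/= andbT; apply/negP; rewrite -leNgt.
Qed.

(** With F = r |f|, pass to the variable s = h(y), translate s by t, and pass back
    to x = h^-1(s). *)
Lemma integral_transport (t : R) (f : R -> R) : measurable_fun [set: mR] f ->
  (\int[xpow_measure alpha]_y `|transport t f y|%:E =
   \int[leb]_x (`|f x| * weight t x)%:E)%E.
Proof.
move=> mf.
have mtf := measurable_transport t mf.
rewrite integral_xpow; last 2 first.
- by apply/measurable_EFinP; exact: measurableT_comp.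
- by move=> x; rewrite lee_fin.
have mrf : measurable_fun [set: mR] (fun x => rate x * `|f x|).
  by apply: measurable_funM; [exact: measurable_rate|exact: measurableT_comp].
pose F s := rate s * `|f s|.
transitivity (\int[leb]_y ((F (k (clock0 y - t)) * weight 0 y)%:E * (pace y)%:E))%E.
  apply: eq_integral => y _; rewrite -!EFinM; congr EFin.
  by rewrite /transport !normrM (ger0_norm (rate_ge0 _)) (ger0_norm (pace_ge0 _)) mulrAC.
rewrite -(@integral_clockV (fun y => (F (k (clock0 y - t)) * weight 0 y)%:E)); last 2 first.
- apply/measurable_EFinP; apply: measurable_funM; last exact: measurable_weight.
  by apply: (measurableT_comp mrf); exact: measurable_shift_clock0.
- by move=> x; rewrite lee_fin mulr_ge0 ?weight_ge0// mulr_ge0// rate_ge0.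
pose H s := F (k s) * weight 0 (k (s + t)).
transitivity (\int[leb]_s (H (s - t))%:E)%E.
  by apply: eq_integral => s _; rewrite /H subrK clock0E// clockVK.
rewrite (lebesgue_integral_shift (- t) (g := EFin \o H)); last 2 first.
- apply/measurable_EFinP; apply: measurable_funM.
    exact: (measurableT_comp mrf mk).
  apply: (measurableT_comp (measurable_weight 0)).
  by apply: (measurableT_comp mk); exact: measurable_funD.
- by move=> x; rewrite lee_fin mulr_ge0 ?weight_ge0// mulr_ge0// rate_ge0.
transitivity (\int[leb]_s (F (k s) * weight t (k s))%:E)%E.
  by apply: eq_integral => s _ /=; rewrite /H weight0// weightE// clockVK.
have mFw : measurable_fun [set: mR] (EFin \o (fun x => F x * weight t x)).
  by apply/measurable_EFinP; apply: measurable_funM => //; exact: measurable_weight.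
have Fw0 (x : R) : (0 <= (F x * weight t x)%:E)%E.
  by rewrite lee_fin mulr_ge0 ?weight_ge0// mulr_ge0// rate_ge0.
rewrite [LHS](integral_clockV mFw Fw0).
apply: eq_integral => x _; rewrite -EFinM; congr EFin.
have [x0|x0] := ltP 0 x; last by rewrite weight_npos// !mulr0 mul0r.
rewrite /F mulrAC.
by rewrite -(mulrA (rate x)) (mulrC `|f x|) mulrA rate_pace// mul1r.
Qed.

Lemma ae_gt0 : \forall x \ae xpow_measure alpha, 0 < x.
Proof.
exists (`]-oo, 0]%classic : set mR); split.
- exact: measurable_itv.
- rewrite /xpow_measure/= (_ : _ `&` _ = set0) ?integral_set0//.
  rewrite -subset0 => x /=; rewrite !in_itv/= andbT => -[x0].
  by rewrite ltNge x0.
- by move=> x /=; rewrite in_itv/= => /negP; rewrite -leNgt.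
Qed.

(** For a null set N containing the exceptional points, the weighted integral of
    1_N vanishes, hence so does the integral of the transport of 1_N. On ]0, +oo[
    that function is the indicator of the preimage of N times a positive factor. *)
Lemma ae_transport t (P : R -> Prop) : (\forall x \ae xpow_measure alpha, P x) ->
  \forall y \ae xpow_measure alpha, P (k (clock0 y - t)).
Proof.
move=> [N [mN N0 PN]].
have m1 : measurable_fun [set: mR] (\1_N : R -> R) by exact: measurable_indic.
have I0 : (\int[xpow_measure alpha]_y `|transport t \1_N y|%:E = 0)%E.
  rewrite integral_transport//.
  have : (\int[leb]_x `|(\1_N x * weight 0 x)%:E| = 0)%E.
    have I1 : (\int[xpow_measure alpha]_x (\1_N x)%:E = 0)%E.
      by rewrite integral_indic// setIT; exact: N0.
    rewrite -[RHS]I1 integral_xpow.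
    - by apply: eq_integral => x _; rewrite /= normrM (ger0_norm (weight_ge0 _ _)) ger0_norm.
    - exact/measurable_EFinP.
    - by move=> x; rewrite lee_fin.
  have mw t' : measurable_fun [set: mR] (EFin \o (fun x => \1_N x * weight t' x)).
    by apply/measurable_EFinP; apply: measurable_funM => //; exact: measurable_weight.
  move=> /(ae_eq_integral_abs leb measurableT (mw 0)) H.
  have -> : (\int[leb]_x (`|\1_N x| * weight t x)%:E = \int[leb]_x `|(\1_N x * weight t x)%:E|)%E.
    by apply: eq_integral => x _; rewrite /= normrM (ger0_norm (weight_ge0 _ _)).
  apply/(ae_eq_integral_abs leb measurableT (mw t)).
  apply: filterS H => x /= H _; have := H Logic.I.
  have [x0|x0] := ltP 0 x; last by rewrite !weight_npos// mulr0.
  move=> [] /eqP; rewrite weight0// mulf_eq0 powR_eq0 (gt_eqF x0)/= orbF => /eqP ->.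
  by rewrite mul0r.
have mt : measurable_fun [set: mR] (EFin \o transport t \1_N).
  by apply/measurable_EFinP; exact: measurable_transport.
have /(ae_eq_integral_abs _ measurableT mt) T0 : 
  (\int[xpow_measure alpha]_y `|(transport t \1_N y)%:E| = 0)%E by [].
apply: filterS2 T0 ae_gt0 => y + y0 => /(_ Logic.I)/= [/eqP].
rewrite /transport !mulf_eq0.
have /gt_eqF -> : 0 < rate (k (clock0 y - t)) by rewrite rateE// r_gt0.
have /gt_eqF -> : 0 < pace y by rewrite paceE// invr_gt0 r_gt0.
rewrite orbF/= indicE pnatr_eq0 eqb0 => /negP yN.
apply: contrapT => nP; apply: yN; rewrite inE; exact: PN.
Qed.

Local Notation mu := (xpow_measure alpha).

(** * Algebra and boundedness of the transport *)

Lemma ae_transport_eq t (f g : R -> R) : (\forall x \ae mu, f x = g x) ->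
  \forall y \ae mu, transport t f y = transport t g y.
Proof.
by move=> /(ae_transport t); apply: filterS => y fg; rewrite /transport fg.
Qed.

Lemma transport_comp s t (f : R -> R) (y : R) :
  transport s (transport t f) y = transport (s + t) f y.
Proof.
have [y0|y0] := ltP 0 y; last by rewrite !transport_npos.
rewrite /transport clock0E// [in LHS](clock0E (clockV_gt0 _)) clockVK -addrA -opprD.
by rewrite [rate (k _) * _]mulrCA rate_pace// mulr1.
Qed.

Lemma transport0 (f : R -> R) (y : R) : 0 < y -> transport 0 f y = f y.
Proof.
move=> y0; rewrite /transport subr0 clock0E// clockK// mulrAC rate_pace// mul1r//.
Qed.

Lemma transportD t (f g : R -> R) (y : R) :
  transport t (fun x => f x + g x) y = transport t f y + transport t g y.
Proof. by rewrite /transport mulrDr mulrDl. Qed.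

Lemma transportZ t c (f : R -> R) (y : R) :
  transport t (fun x => c * f x) y = c * transport t f y.
Proof. by rewrite /transport (mulrCA (rate _)) -[LHS]mulrA. Qed.

(** Equivalent to the boundedness of U0(t) by K. *)
Definition weight_bound t K := forall x : R, 0 < x ->
  k (clock r x + t) `^ alpha <= K * x `^ alpha.

Lemma weight_bound_le t K x : weight_bound t K -> weight t x <= K * weight 0 x.
Proof.
move=> H; have [x0|x0] := ltP 0 x; last by rewrite !weight_npos// mulr0.
by rewrite weight0// weightE// H.
Qed.

Lemma weight_bound_ge0 t K : weight_bound t K -> 0 <= K.
Proof. by move=> /(_ _ ltr01); rewrite powR1 mulr1; apply: le_trans; exact: powR_ge0. Qed.

Lemma integral_transport_le t K (f : R -> R) : weight_bound t K ->
  measurable_fun [set: mR] f ->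
  (\int[mu]_y `|transport t f y|%:E <= K%:E * \int[mu]_x `|f x|%:E)%E.
Proof.
move=> H mf; have K0 := weight_bound_ge0 H; rewrite integral_transport//.
have mnf : measurable_fun [set: mR] (fun x => `|f x|) by exact: measurableT_comp.
have mfw t' : measurable_fun [set: mR] (fun x => `|f x| * weight t' x).
  by apply: measurable_funM => //; exact: measurable_weight.
rewrite (@integral_xpow (fun x => `|f x|%:E)); last 2 first.
- exact/measurable_EFinP.
- by move=> x; rewrite lee_fin.
rewrite -ge0_integralZl//; last 2 first.
- by apply: emeasurable_funM; apply/measurable_EFinP => //; exact: measurable_weight.
- by move=> x _; rewrite lee_fin mulr_ge0// weight_ge0.
apply: ge0_le_integral => //.
- by move=> x _; rewrite lee_fin mulr_ge0// weight_ge0.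
- exact/measurable_EFinP.
- apply: emeasurable_funM => //; apply: emeasurable_funM; apply/measurable_EFinP => //.
  exact: measurable_weight.
- move=> x _; rewrite -!EFinM lee_fin mulrCA ler_wpM2l//.
  exact: weight_bound_le.
Qed.

Lemma transport_integrable t K (f : R -> R) : weight_bound t K ->
  mu.-integrable [set: mR] (EFin \o f) ->
  mu.-integrable [set: mR] (EFin \o transport t f).
Proof.
move=> H fi; have mf : measurable_fun [set: mR] f.
  by apply/measurable_EFinP; exact: measurable_int fi.
apply/integrableP; split.
  by apply/measurable_EFinP; exact: measurable_transport.
apply: le_lt_trans (integral_transport_le H mf) _.
apply: lte_mul_pinfty; rewrite ?lee_fin ?(weight_bound_ge0 H)//.
by have [_] := integrableP _ _ _ fi.
Qed.

Hypothesis alpha_ge0 : 0 <= alpha.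

Lemma powR_mono (x y : R) : 0 <= x -> x <= y -> x `^ alpha <= y `^ alpha.
Proof.
by move=> x0 xy; apply: ge0_ler_powR => //; rewrite nnegrE// (le_trans x0).
Qed.

Lemma weight_bound_mono s t K : s <= t -> weight_bound t K -> weight_bound s K.
Proof.
move=> st H x x0; apply: le_trans (H x x0); apply: powR_mono; first exact: ltW.
by rewrite clockV_leE lerD2l.
Qed.

Let indic_clockV (a b s : R) : 0 < a -> 0 < b ->
  \1_(`]a, b]) (k s) = \1_(`]clock r a, clock r b]) s :> R.
Proof.
move=> a0 b0; rewrite !indicE; congr (_%:R); congr nat_of_bool.
apply/idP/idP; rewrite !inE/= !in_itv/=;
  by rewrite clock_lt_clockV// clockV_le_clock.
Qed.

(** The function 1_]a, b] / r, which the flow transports to a function of the same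
    form. *)
Definition pace_on (a b : R) : R -> R := fun x => \1_(`]a, b]) x * pace x.

Let measurable_on (a b : R) : measurable_fun [set: mR] (\1_(`]a, b]%classic : set mR) : mR -> R).
Proof. by apply: measurable_indic; exact: measurable_itv. Qed.

Let measurable_onk (a b s : R) : measurable_fun [set: mR]
  (fun y => \1_(`]a, b]%classic : set mR) (k (clock0 y - s)) : R).
Proof. exact: (measurableT_comp (measurable_on a b) (measurable_shift_clock0 (- s))). Qed.

(** Integrals with respect to x^alpha dx of functions f / r, in the variable
    s = h(x): the factor 1 / r is absorbed by the change of variables. *)
Lemma integral_pace (f : R -> R) : measurable_fun [set: mR] f -> (forall x, 0 <= f x) ->
  (\int[mu]_y (f y * pace y)%:E = \int[leb]_s (f (k s) * k s `^ alpha)%:E)%E.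
Proof.
move=> mf f0.
rewrite integral_xpow; last 2 first.
- by apply/measurable_EFinP; apply: measurable_funM => //; exact: measurable_pace.
- by move=> x; rewrite lee_fin mulr_ge0// pace_ge0.
pose g x := f x * weight 0 x.
have mg : measurable_fun [set: mR] (EFin \o g).
  by apply/measurable_EFinP; apply: measurable_funM => //; exact: measurable_weight.
have g0 (x : R) : (0 <= (g x)%:E)%E by rewrite lee_fin mulr_ge0// weight_ge0.
transitivity (\int[leb]_s (g (k s))%:E)%E.
  rewrite [RHS](integral_clockV mg g0).
  by apply: eq_integral => x _; rewrite -!EFinM mulrAC.
by apply: eq_integral => s _; rewrite /g weight0.
Qed.

Let integral_step (c a b : R) : 0 <= c -> 0 <= b ->
  (\int[leb]_s (c * \1_(`]a, a + b]) s)%:E = (c * b)%:E)%E.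
Proof.
move=> c0 b0; under eq_integral do rewrite EFinM.
rewrite ge0_integralZl//; last exact/measurable_EFinP.
rewrite integral_indic ?setIT; last 2 first.
- exact: measurableT.
- exact: measurable_itv.
rewrite [X in (_ * X)%E](lebesgue_measure_itv `]a, a + b])/= lte_fin ltrDl; case: ltP => [b0'|b0'].
  by rewrite -EFinB addrAC subrr add0r -EFinM.
by rewrite mule0 (_ : b = 0) ?mulr0//; apply/eqP; rewrite eq_le b0 b0'.
Qed.

Let measurable_step (c a b : R) : measurable_fun [set: mR]
  (EFin \o (fun s => c * \1_(`]a, b]%classic : set mR) s)).
Proof. by apply/measurable_EFinP; apply: measurable_funM => //; exact: measurable_on. Qed.

Lemma pace_on_integrable (a b : R) : 0 < a ->
  mu.-integrable [set: mR] (EFin \o pace_on a b).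
Proof.
move=> a0.
have mp : measurable_fun [set: mR] (pace_on a b).
  by apply: measurable_funM; [exact: measurable_on|exact: measurable_pace].
apply/integrableP; split; first exact/measurable_EFinP.
have [ba|ab] := ltP b a.
  under eq_integral do rewrite /= /pace_on set_itv_ge ?bnd_simp -?leNgt ?(ltW ba)// indic0/= mul0r normr0.
  by rewrite integral0.
have b0 := lt_le_trans a0 ab.
under eq_integral do rewrite /= normrM (ger0_norm (pace_ge0 _)) ger0_norm//.
rewrite integral_pace//.
have hab : clock r a <= clock r b by rewrite clock_leE.
apply: (@le_lt_trans _ _ (b `^ alpha * (clock r b - clock r a))%:E); last exact: ltry.
rewrite -(integral_step (clock r a)) ?powR_ge0 ?subr_ge0// (addrC (clock r a)) subrK.
apply: ge0_le_integral => //.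
- by move=> s _; rewrite lee_fin mulr_ge0// powR_ge0.
- apply/measurable_EFinP/measurable_funM.
    exact: (measurableT_comp (measurable_on a b) mk).
  exact: (measurableT_comp (measurable_powR alpha) mk).
- exact: measurable_step.
- move=> s _; rewrite lee_fin mulrC indic_clockV//.
  rewrite indicE; case: (boolP (_ \in _)) => [|_]; last by rewrite !mulr0.
  rewrite inE/= in_itv/= !mulr1 => /andP[_ sb]; apply: powR_mono; first exact: ltW.
  by rewrite clockV_le_clock.
Qed.

Lemma transport_pace_on t (a b y : R) :
  transport t (pace_on a b) y = \1_(`]a, b]) (k (clock0 y - t)) * pace y.
Proof. by rewrite /transport /pace_on mulrCA rate_pace// mulr1. Qed.

(** In the variable s = h(y) the two functions are the indicators of an interval and
    of its translate by t, with weight (h^-1(s))^alpha. They differ for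
    s <= h(b) + t at most, where t <= 1 bounds the weight. *)
Lemma transport_pace_on_le (a b t : R) : 0 < a -> a <= b -> 0 <= t -> t <= 1 ->
  (\int[mu]_y `|transport t (pace_on a b) y - pace_on a b y|%:E <=
   (k (clock r b + 1) `^ alpha * t *+ 2)%:E)%E.
Proof.
move=> a0 ab t0 t1; have b0 := lt_le_trans a0 ab.
have hab : clock r a <= clock r b by rewrite clock_leE.
pose C := k (clock r b + 1) `^ alpha; have C0 : 0 <= C by exact: powR_ge0.
pose D (y : R) : R := `|\1_(`]a, b]) (k (clock0 y - t)) - \1_(`]a, b]) y|.
have mD : measurable_fun [set: mR] D.
  apply: measurableT_comp => //; apply: measurable_funB; first exact: measurable_onk.
  exact: measurable_on.
rewrite [X in (X <= _)%E](_ : _ = \int[mu]_y (D y * pace y)%:E)%E; last first.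
  apply: eq_integral => y _; congr EFin.
  by rewrite transport_pace_on /pace_on -mulrBl normrM (ger0_norm (pace_ge0 _)).
rewrite integral_pace//; last by move=> y; exact: normr_ge0.
apply: (@le_trans _ _ (\int[leb]_s ((C * \1_(`]clock r a, clock r a + t]) s)%:E +
   (C * \1_(`]clock r b, clock r b + t]) s)%:E))%E).
  apply: ge0_le_integral => //.
  - by move=> s _; rewrite lee_fin; apply: mulr_ge0; [exact: normr_ge0|exact: powR_ge0].
  - apply/measurable_EFinP/measurable_funM; first exact: (measurableT_comp mD mk).
    exact: (measurableT_comp (measurable_powR alpha) mk).
  - by apply: emeasurable_funD; exact: measurable_step.
  - move=> s _; rewrite -EFinD lee_fin -mulrDr mulrC.
    rewrite /D clock0E// clockVK !indic_clockV//.
    have [PQ Ps] := indic_shift_diff_le s t0 hab.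
    have [->|/Ps sb] := eqVneq (`|\1_(`]clock r a, clock r b]) (s - t) -
        \1_(`]clock r a, clock r b]) s| : R) 0.
      by rewrite mulr0 mulr_ge0// addr_ge0.
    apply: ler_pM => //; first exact: powR_ge0.
    apply: powR_mono; first exact: ltW.
    by rewrite clockV_leE (le_trans sb)// lerD2l.
rewrite ge0_integralD//; last 4 first.
- by move=> s _; rewrite lee_fin mulr_ge0.
- exact: measurable_step.
- by move=> s _; rewrite lee_fin mulr_ge0.
- exact: measurable_step.
by rewrite !(integral_step _ C0 t0) -EFinD mulr2n lexx.
Qed.

(** * The semigroup on the weighted space *)

Definition flow_op (t : R) (u : Xspace alpha) : Xspace alpha := toL1 mu (transport t u).
Local Notation T := flow_op.
Implicit Types u v : Xspace alpha.
Implicit Types S : R -> Xspace alpha -> Xspace alpha.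

Lemma flow_opE t K u : weight_bound t K ->
  \forall y \ae mu, T t u y = transport t u y.
Proof. by move=> H; apply: toL1E; apply: transport_integrable H _; exact: L1_integrable. Qed.

Lemma flow_op_norm t K u : weight_bound t K -> `|T t u| <= K * `|u|.
Proof.
move=> H; have tu := transport_integrable H (L1_integrable u).
rewrite -lee_fin EFinM toL1_norm// L1_normE.
by apply: integral_transport_le => //; exact: L1_measurable.
Qed.

Lemma flow_op_linear t K c u v : weight_bound t K ->
  T t (c *: u + v) = c *: T t u + T t v.
Proof.
move=> H; apply: toL1_unique.
have uv : \forall x \ae mu, (c *: u + v : L1 mu) x = c * u x + v x.
  have := L1_addE (c *: u) v; have := L1_scaleE c u.
  by apply: filterS2 => x cu ->; rewrite [X in X + _]cu.
have tuv := ae_transport_eq t uv.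
have TT : \forall x \ae mu, (c *: T t u + T t v : L1 mu) x = c * T t u x + T t v x.
  have := L1_addE (c *: T t u) (T t v); have := L1_scaleE c (T t u).
  by apply: filterS2 => x cu ->; rewrite [X in X + _]cu.
have Tuv : \forall x \ae mu, c * T t u x + T t v x = c * transport t u x + transport t v x.
  by apply: filterS2 (flow_opE u H) (flow_opE v H) => x -> ->.
apply: filterS3 tuv TT Tuv => x -> -> ->.
by rewrite transportD transportZ.
Qed.

Lemma flow_opD t K u v : weight_bound t K -> T t (u + v) = T t u + T t v.
Proof. by move=> /(flow_op_linear 1 u v); rewrite !scale1r. Qed.

Lemma flow_opZ t K c u : weight_bound t K -> T t (c *: u) = c *: T t u.
Proof.
move=> H; have T0 : T t 0 = 0.
  by apply/eqP; rewrite -normr_le0 (le_trans (flow_op_norm 0 H))// normr0 mulr0.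
by rewrite -[c *: u]addr0 (flow_op_linear _ _ _ H) T0 addr0.
Qed.

Lemma flow_opB t K u v : weight_bound t K -> T t (u - v) = T t u - T t v.
Proof.
by move=> H; rewrite -scaleN1r (flow_opD _ _ H) (flow_opZ _ _ H) scaleN1r.
Qed.

Lemma flow_op0 u : T 0 u = u.
Proof.
apply: toL1_unique; apply: filterS ae_gt0 => x x0.
by rewrite transport0.
Qed.

Lemma flow_op_comp s t Ks K u : weight_bound s Ks -> weight_bound t K ->
  T (s + t) u = T s (T t u).
Proof.
move=> Hs H; apply: toL1_unique.
have E := ae_transport_eq s (flow_opE u H).
apply: filterS2 E (flow_opE (T t u) Hs) => x E ->.
by rewrite E transport_comp.
Qed.

Lemma flow_op_pace_on (a b t K : R) : 0 < a -> a <= b -> 0 <= t -> t <= 1 ->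
  weight_bound t K ->
  `|T t (toL1 mu (pace_on a b)) - toL1 mu (pace_on a b)| <=
  k (clock r b + 1) `^ alpha * t *+ 2.
Proof.
move=> a0 ab t0 t1 H; have pi := pace_on_integrable b a0.
have -> : T t (toL1 mu (pace_on a b)) = toL1 mu (transport t (pace_on a b)).
  apply/esym/toL1_unique.
  apply: filterS2 (flow_opE (toL1 mu (pace_on a b)) H) (ae_transport_eq t (toL1E pi)).
  by move=> x -> ->.
have tpi := transport_integrable H pi.
rewrite -toL1B// -lee_fin toL1_norm; first exact: transport_pace_on_le.
exact: (integrableB measurableT tpi pi).
Qed.

(** The bound K is common to all t in [0, 1] because the weights increase with t.
    Hence the set of u for which the convergence holds is a closed subspace, and it
    contains the total family of functions 1_]a, b] / r. *)
Lemma flow_op_strongly_continuous K u : weight_bound 1 K -> T t u @[t --> 0^'+] --> u.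
Proof.
move=> H1; have K0 := weight_bound_ge0 H1.
have H t : t <= 1 -> weight_bound t K by move=> t1; exact: weight_bound_mono H1.
have near01 : \forall t \near (0:R)^'+, 0 <= t <= 1.
  near=> t; apply/andP; split => //.
  by near: t; exact: nbhs_right_le.
apply: (@L1_indic_itv_total _ _ rate pace measurable_rate measurable_pace rate_ge0 pace_ge0 rate_pace ae_gt0
  _ [set u | T t u @[t --> 0^'+] --> u]).
- by move=> a b a0; exact: pace_on_integrable.
- move=> v w /= Gv Gw.
  apply: (cvg_trans _ (cvgD Gv Gw)); apply: near_eq_cvg.
  near=> t.
  have /andP[t0 t1] : 0 <= t <= 1 by near: t.
  by rewrite (flow_opD _ _ (H t t1)).
- move=> c v /= Gv.
  apply: (cvg_trans _ (cvgZl_tmp (k := c) Gv)); apply: near_eq_cvg.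
  near=> t.
  have /andP[t0 t1] : 0 <= t <= 1 by near: t.
  by rewrite (flow_opZ _ _ (H t t1)).
- move=> u_ v /= Gu uv; apply/cvgrPdistC_le => e e0.
  (* The two terms that contain v - u_ N contribute at most (K + 1) |v - u_ N|. *)
  have d0 : 0 < e / 2 / (K + 1) by rewrite !divr_gt0// ltr_wpDl.
  have [N _ /(_ N (leqnn N)) /= vN] := (cvgrPdist_le _ _).1 uv _ d0.
  have e20 : 0 < e / 2 by rewrite divr_gt0.
  have near_e : \forall t \near 0^'+, `|T t (u_ N) - u_ N| <= e / 2.
    by move: (Gu N) => /cvgrPdistC_le; apply.
  near=> t.
  have /andP[t0 t1] : 0 <= t <= 1 by near: t.
  have TN : `|T t (u_ N) - u_ N| <= e / 2 by near: t.
  rewrite (_ : T t v - v = T t (v - u_ N) + (T t (u_ N) - u_ N) + (u_ N - v)); last first.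
    by rewrite (flow_opB _ _ (H t t1)) !addrA !subrK.
  rewrite (le_trans (ler_normD _ _))//.
  rewrite (le_trans (lerD (ler_normD _ _) (lexx _)))//.
  have TvN := flow_op_norm (v - u_ N) (H t t1).
  have : K * `|v - u_ N| + `|v - u_ N| <= e / 2.
    by rewrite -{2}[`|v - u_ N|]mul1r -mulrDl mulrC -ler_pdivlMr// ltr_wpDl.
  rewrite (distrC (u_ N) v); lra.
- move=> a b a0 /=.
  (* For b < a both intervals are empty; the maximum puts the end points in order. *)
  have -> : (fun x => \1_(`]a, b]) x * pace x) = pace_on a (Num.max a b).
    apply/funext => x; rewrite /pace_on; case: (leP a b) => // ba.
    by rewrite !set_itv_ge// -leNgt bnd_simp// ltW.
  have amax : a <= Num.max a b by rewrite le_max lexx.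
  pose C := k (clock r (Num.max a b) + 1) `^ alpha.
  have C0 : 0 <= C by exact: powR_ge0.
  apply/cvgrPdistC_le => e e0; near=> t.
  have /andP[t0 t1] : 0 <= t <= 1 by near: t.
  apply: le_trans (flow_op_pace_on a0 amax t0 t1 (H t t1)) _.
  rewrite -/C.
  have : t <= e / (C * 2 + 1).
    by near: t; apply: nbhs_right_le; rewrite divr_gt0// ltr_wpDl// mulr_ge0.
  rewrite ler_pdivlMr; last by rewrite ltr_wpDl// mulr_ge0.
  rewrite -mulr_natr; nra.
Unshelve. all: by end_near. Qed.

(** * Norms, growth and existence of the semigroup *)

Lemma growthP t (M : R) : 0 <= t ->
  (growth r t <= M%:E)%E <-> forall x : R, 0 < x -> k (clock r x + t) <= M * x.
Proof.
move=> t0; rewrite /growth; split => [H x x0|H].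
  rewrite -ler_pdivrMr// -lee_fin -(charyE x0 t0).
  apply: le_trans H; apply: ereal_sup_ubound; exists x => //=.
  by rewrite in_itv/= x0.
apply: ge_ereal_sup => _ [x /= + <-]; rewrite in_itv/= andbT => x0.
by rewrite lee_fin ler_pdivrMr// (charyE x0 t0) H.
Qed.

Lemma growth_ge0 t : 0 <= t -> (0 <= growth r t)%E.
Proof.
move=> t0; have : 0 <= chary r 1 t / 1.
  by rewrite (charyE ltr01 t0) divr1 ltW.
rewrite -lee_fin => /le_trans; apply; apply: ereal_sup_ubound; exists 1 => //=.
by rewrite in_itv/= ltr01.
Qed.

Lemma growth_fin t : 0 <= t -> (growth r t < +oo)%E -> exists M : R, growth r t = M%:E.
Proof.
move=> t0 fin; exists (fine (growth r t)).
by rewrite fineK// ge0_fin_numE ?growth_ge0.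
Qed.

Lemma growth_mono s t : 0 <= s -> s <= t -> (growth r s <= growth r t)%E.
Proof.
move=> s0 st; have t0 := le_trans s0 st.
apply: ge_ereal_sup => _ [x /= + <-]; rewrite in_itv/= andbT => x0.
apply: (@le_trans _ _ (chary r x t / x)%:E).
  rewrite lee_fin ler_pM2r ?invr_gt0// !charyE//.
  by rewrite clockV_leE lerD2l.
by apply: ereal_sup_ubound; exists x => //=; rewrite in_itv/= x0.
Qed.

(** By monotonicity the value at t0 + 1 is a bound in a neighbourhood of t0. *)
Lemma locally_bounded_growth : (forall t, 0 <= t -> (growth r t < +oo)%E) ->
  locally_bounded_nneg (growth r).
Proof.
move=> fin t0 t00.
have t10 : 0 <= t0 + 1 by rewrite addr_ge0.
have [M ME] := growth_fin t10 (fin _ t10).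
exists M; near=> t => tge0; rewrite -ME; apply: growth_mono => //.
by apply: ltW; near: t; apply: lt_nbhsl; rewrite ltrDl.
Unshelve. all: by end_near. Qed.

Lemma growth_weight_bound t (M : R) : 0 <= t -> (growth r t <= M%:E)%E ->
  weight_bound t (M `^ alpha).
Proof.
move=> t0 /(growthP _ t0) H x x0.
have M0 : 0 <= M by have := H _ ltr01; rewrite mulr1; apply: le_trans; exact: ltW.
rewrite -powRM//; last exact: ltW.
by apply: powR_mono; [exact: ltW|exact: H].
Qed.

Lemma weight_bound_growth t (K : R) : 0 < alpha -> 0 <= t -> weight_bound t K ->
  (growth r t <= (K `^ alpha^-1)%:E)%E.
Proof.
move=> a0 t0 H; apply/(growthP _ t0) => x x0.
have inv (z : R) : 0 < z -> z = (z `^ alpha) `^ alpha^-1.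
  by move=> z0; rewrite -powRrM divff ?gt_eqF// powRr1// ltW.
rewrite [leLHS](inv _ (clockV_gt0 _)) [x in leRHS](inv _ x0).
rewrite -powRM ?powR_ge0 ?(weight_bound_ge0 H)//.
apply: ge0_ler_powR; rewrite ?invr_ge0// ?nnegrE ?powR_ge0//.
  by rewrite mulr_ge0 ?powR_ge0 ?(weight_bound_ge0 H).
exact: H.
Qed.

Lemma flow_op_continuous t K : weight_bound t K -> continuous (T t).
Proof.
move=> H u; have K0 := weight_bound_ge0 H.
apply/(@cvgrPdist_le _ _ _ (nbhs u)) => e e0; near=> v.
rewrite -(flow_opB _ _ H); apply: le_trans (flow_op_norm _ H) _.
have : `|u - v| <= e / (K + 1).
  by near: v; apply: cvgr_dist_le => //; rewrite divr_gt0// ltr_wpDl.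
rewrite ler_pdivlMr ?ltr_wpDl// => /(le_trans _); apply.
by rewrite mulrC ler_wpM2l// lerDl.
Unshelve. all: by end_near. Qed.

Lemma flow_op_semigroup : (forall t, 0 <= t -> (growth r t < +oo)%E) ->
  U0_positive_semigroup r T.
Proof.
move=> fin.
have bnd t : 0 <= t -> exists K, weight_bound t K.
  move=> t0; have [M ME] := growth_fin t0 (fin t t0).
  by exists (M `^ alpha); apply: growth_weight_bound => //; rewrite ME.
split.
- move=> t f t0; have [K H] := bnd t t0.
  apply: filterS3 ae_gt0 (flow_opE (\pi_(Xspace alpha) f) H)
    (ae_transport_eq t (L1_pi_ae f)) => y y0 -> ->.
  exact: transportE.
- split.
  + move=> t t0; have [K H] := bnd t t0; split; last exact: flow_op_continuous H.
    by move=> c u v; exact: flow_op_linear H.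
  + exact: flow_op0.
  + move=> s t u s0 t0; have [K H] := bnd t t0; have [K' H'] := bnd s s0.
    exact: flow_op_comp H' H.
  + by move=> u; have [K H] := bnd 1 ler01; exact: flow_op_strongly_continuous H.
- move=> t t0 u u0; have [K H] := bnd t t0.
  apply: filterS2 (flow_opE u H) (ae_transport t u0) => y -> uy.
  by rewrite /transport mulr_ge0 ?pace_ge0// mulr_ge0 ?rate_ge0.
Qed.

(** A semigroup given by U0 on the classes of integrable functions agrees with the
    transport of any chosen representative. *)
Lemma U0_semigroupE S (t : R) u :
  U0_positive_semigroup r S -> 0 <= t ->
  \forall y \ae mu, S t u y = transport t u y.
Proof.
move=> [SE _ _] t0.
have aux v : v = u -> (\forall y \ae mu, S t v y = U0 r t u y) ->
    \forall y \ae mu, S t u y = transport t u y.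
  by move=> ->; apply: filterS2 ae_gt0 => y y0 ->; rewrite transportE.
apply: (aux (\pi_(Xspace alpha) (repr u))); first exact: reprK.
exact: SE.
Qed.

Lemma integral_indic_weight (a b t : R) : 0 < a -> a <= b -> 0 <= t ->
  ((k (clock r a + t) `^ alpha * (b - a))%:E <=
   \int[leb]_x (\1_(`]a, b]) x * weight t x)%:E)%E /\
  (\int[leb]_x (\1_(`]a, b]) x * weight t x)%:E <=
    (k (clock r b + t) `^ alpha * (b - a))%:E)%E.
Proof.
move=> a0 ab t0.
have ba0 : 0 <= b - a by rewrite subr_ge0.
have mw : measurable_fun [set: mR] (fun x => \1_(`]a, b]) x * weight t x).
  by apply: measurable_funM; [exact: measurable_on|exact: measurable_weight].
split; rewrite -(integral_step a)// ?powR_ge0// (addrC a) subrK.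
- apply: ge0_le_integral => //.
  + by move=> x _; rewrite lee_fin mulr_ge0 ?powR_ge0.
  + exact: measurable_step.
  + exact/measurable_EFinP.
  + move=> x _; rewrite lee_fin mulrC.
    rewrite indicE; case: (boolP (_ \in _)) => [|_]; last by rewrite !mul0r.
    rewrite inE/= in_itv/= !mul1r => /andP[ax _]; have x0 := lt_trans a0 ax.
    rewrite (weightE t x0); apply: powR_mono; first exact: ltW.
    by rewrite clockV_leE lerD2r (clock_leE a0 x0) ltW.
- apply: ge0_le_integral => //.
  + by move=> x _; rewrite lee_fin mulr_ge0 ?weight_ge0.
  + exact/measurable_EFinP.
  + exact: measurable_step.
  + move=> x _; rewrite lee_fin mulrC.
    rewrite indicE; case: (boolP (_ \in _)) => [|_]; last by rewrite !mulr0.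
    rewrite inE/= in_itv/= !mulr1 => /andP[ax xb]; have x0 := lt_trans a0 ax.
    rewrite (weightE t x0); apply: powR_mono; first exact: ltW.
    by rewrite clockV_leE lerD2r (clock_leE x0 (lt_le_trans x0 xb)).
Qed.

Lemma indic_integrable (a b : R) : 0 < a -> a <= b ->
  mu.-integrable [set: mR] (EFin \o (\1_(`]a, b]%classic : set mR) : mR -> R)).
Proof.
move=> a0 ab; apply/integrableP; split; first by apply/measurable_EFinP; exact: measurable_on.
rewrite integral_xpow; last 2 first.
- by apply: measurableT_comp => //; apply/measurable_EFinP; exact: measurable_on.
- by move=> x; exact: abse_ge0.
have [_ ub] := integral_indic_weight a0 ab (lexx 0).
apply: le_lt_trans (le_lt_trans ub (ltry _)).
by under [X in (X <= _)%E]eq_integral do rewrite /= ger0_norm// -EFinM.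
Qed.

(** On the indicator of ]x, x1] the norm of the image is at least
    y(x, t)^alpha (x1 - x), as y(., t) is increasing, and the norm of the indicator
    is at most x1^alpha (x1 - x). Divide by x1 - x and let x1 decrease to x. *)
Lemma weight_bound_of_norm_le (A : Xspace alpha -> Xspace alpha) t K : 0 <= t -> 0 <= K ->
  (forall u, \forall y \ae mu, A u y = transport t u y) ->
  (forall u, `|A u| <= K * `|u|) -> weight_bound t K.
Proof.
move=> t0 K0 AE AK.
have step (x x1 : R) : 0 < x -> x < x1 -> k (clock r x + t) `^ alpha <= K * x1 `^ alpha.
  move=> x0 xx1; have x10 := lt_trans x0 xx1.
  have ii := indic_integrable x0 (ltW xx1).
  pose u := toL1 mu (\1_(`]x, x1]%classic : set mR) : mR -> R).
  have mi := measurable_on x x1.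
  have Au : \forall y \ae mu, A u y = transport t \1_(`]x, x1]) y.
    by apply: filterS2 (AE u) (ae_transport_eq t (toL1E ii)) => y -> ->.
  have [lb _] := integral_indic_weight x0 (ltW xx1) t0.
  have [_ ub] := integral_indic_weight x0 (ltW xx1) (lexx 0).
  rewrite addr0 clockK// in ub.
  have AuE : `|A u|%:E = (\int[leb]_z (\1_(`]x, x1]) z * weight t z)%:E)%E.
    rewrite L1_normE; transitivity (\int[mu]_y `|transport t \1_(`]x, x1]) y|%:E)%E.
      apply: ae_eq_integral => //.
      - by apply/measurable_EFinP; apply: measurableT_comp => //; exact: L1_measurable.
      - by apply/measurable_EFinP; apply: measurableT_comp => //; exact: measurable_transport.
      - by apply: filterS Au => y -> _.
    by rewrite integral_transport//; apply: eq_integral => z _; rewrite ger0_norm.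
  have uE : `|u|%:E = (\int[leb]_z (\1_(`]x, x1]) z * weight 0 z)%:E)%E.
    rewrite (toL1_norm ii) integral_xpow; last 2 first.
    - by apply/measurable_EFinP; exact: measurableT_comp.
    - by move=> z; rewrite lee_fin.
    by apply: eq_integral => z _; rewrite ger0_norm// EFinM.
  have := AK u; rewrite -uE lee_fin in ub; rewrite -AuE lee_fin in lb.
  move=> /(le_trans lb) H; have := le_trans H (ler_wpM2l K0 ub).
  by rewrite mulrA ler_pM2r// subr_gt0.
move=> x x0.
have powc : {for x, continuous (fun z : R => z `^ alpha)}.
  apply/differentiable_continuous/derivable1_diffP/derivable_powR.
  by rewrite in_itv/= x0.
have cv : K * x1 `^ alpha @[x1 --> x^'+] --> K * x `^ alpha.
  by apply: cvgM; [exact: cvg_cst|exact: cvg_at_right_filter].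
apply: (cvgr_to_ge cv); near=> x1; apply: step => //.
Unshelve. all: by end_near. Qed.

Local Notation flow_ratio t :=
  (ereal_sup [set (chary r x t `^ alpha / x `^ alpha)%:E | x in `]0, +oo[]).

Lemma flow_ratio_leP (t K : R) : 0 <= t ->
  (flow_ratio t <= K%:E)%E <-> weight_bound t K.
Proof.
move=> t0; split => [H x x0|H].
  rewrite -ler_pdivrMr ?powR_gt0// -lee_fin -(charyE x0 t0).
  apply: le_trans H; apply: ereal_sup_ubound; exists x => //=.
  by rewrite in_itv/= x0.
apply: ge_ereal_sup => _ [x /= + <-]; rewrite in_itv/= andbT => x0.
by rewrite lee_fin ler_pdivrMr ?powR_gt0// (charyE x0 t0) H.
Qed.

Lemma U0_semigroup_norm S (t : R) u K :
  U0_positive_semigroup r S -> 0 <= t ->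
  weight_bound t K -> `|S t u| <= K * `|u|.
Proof.
move=> SE t0 H; rewrite (_ : S t u = T t u); first exact: flow_op_norm.
apply: L1_ext; apply: filterS2 (U0_semigroupE u SE t0) (flow_opE u H).
by move=> x -> ->.
Qed.

Lemma U0_semigroup_op_norm S (t : R) :
  U0_positive_semigroup r S -> 0 <= t ->
  op_norm (S t) = flow_ratio t.
Proof.
move=> SE t0; apply: eq_ereal_real_ub => K; rewrite flow_ratio_leP//; split => H.
  have [_ [/(_ _ t0)[lS _] _ _ _] _] := SE.
  have [K0 HK] := (op_norm_leP K lS).1 H.
  by apply: (weight_bound_of_norm_le t0 K0 _ HK) => u; exact: U0_semigroupE.
have [_ [/(_ _ t0)[lS _] _ _ _] _] := SE.
apply/(op_norm_leP K lS); split; first exact: weight_bound_ge0 H.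
by move=> u; exact: U0_semigroup_norm SE t0 H.
Qed.

Lemma U0_semigroup_growth S (t : R) : 0 < alpha ->
  U0_positive_semigroup r S -> 0 <= t ->
  (growth r t < +oo)%E.
Proof.
move=> a0 SE t0; have [_ [/(_ _ t0)[lS cS] _ _ _] _] := SE.
pose f : {linear Xspace alpha -> Xspace alpha} := HB.pack (S t) (GRing.isLinear.Build _ _ _ _ _ lS).
have : bounded_near f (nbhs 0) by apply/continuous_linear_bounded; exact: cS.
move=> /linear_boundedP/pinfty_ex_gt0[K K0 HK].
have H : weight_bound t K.
  apply: (weight_bound_of_norm_le t0 (ltW K0) _ HK) => u; exact: U0_semigroupE.
exact: le_lt_trans (weight_bound_growth a0 t0 H) (ltry _).
Qed.

(** The derivative of C h(z) - ln z is C / r(z) - 1 / z >= 0. Its increment between x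
    and y(x, t) is C t - ln (y(x, t) / x), since h increases by t there. *)
Lemma growth_exp (C t : R) : (forall z : R, 0 < z -> r z <= C * z) -> 0 <= t ->
  (growth r t <= (expR (C * t))%:E)%E.
Proof.
move=> rC t0; apply/(growthP _ t0) => x x0.
have C0 : 0 < C by have := rC _ ltr01; rewrite mulr1; apply: lt_le_trans; exact: r_gt0.
set y := k _; have y0 : 0 < y by exact: clockV_gt0.
have [->|xy] := eqVneq x y; first by rewrite ler_peMl ?(ltW y0)// -expR0 ler_expR mulr_ge0// ltW.
have {}xy : x < y.
  rewrite lt_neqAle xy/= /y -[leLHS]clockK// clockV_leE lerDl//.
pose phi : R -> R := cst C * clock r - (@ln R).
have dphi (z : R) : 0 < z -> is_derive z 1 phi (C * (r z)^-1 - z^-1).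
  move=> z0; apply: is_deriveB; last exact: is_derive1_ln.
  have := is_deriveM (is_derive_cst C z 1) (is_derive_clock z0).
  by rewrite scaler0 addr0.
have [z||z] := MVT xy (f := phi) (df := fun z => C * (r z)^-1 - z^-1).
- by rewrite in_itv/= => /andP[xz _]; apply: dphi; exact: lt_trans xz.
- apply: continuous_in_subspaceT => z.
  rewrite inE/= in_itv/= => /andP[xz _]; have z0 := lt_le_trans x0 xz.
  by have [+ _] := dphi z z0 => /derivable1_diffP/differentiable_continuous.
rewrite in_itv/= => /andP[xz _]; have z0 := lt_trans x0 xz.
have : 0 <= C * (r z)^-1 - z^-1.
  by rewrite subr_ge0 ler_pdivlMr ?r_gt0// mulrC ler_pdivrMr// rC.
move=> d0 E.
have : 0 <= phi y - phi x by rewrite E mulr_ge0// subr_ge0 ltW.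
rewrite /phi !fctE/= /y clockVK -/y.
move=> H; have : ln (y / x) <= C * t.
  rewrite ln_div ?posrE//; lra.
by rewrite -ler_expR lnK ?posrE ?divr_gt0// ler_pdivrMr.
Qed.

End flow.

Theorem theorem4p1 (R : realType) (alpha : R) (r : R -> R)
    (halpha : 0 < alpha)
    (hr_cont : {within `]0, +oo[, continuous r})
    (hr_pos : forall x, 0 < x -> 0 < r x)
    (hr_0 : (\int[lebesgue_measure]_(tau in `]0%R, 1%R]) ((r tau)^-1)%:E = +oo)%E)
    (hr_oo : (\int[lebesgue_measure]_(tau in `[1%R, +oo[) ((r tau)^-1)%:E = +oo)%E) :
  [/\ forall t y, 0 <= t -> 0 < y ->
        derivable (fun z => charX r z t) y 1 /\
        forall f : R -> R,
          U0 r t f y = f (charX r y t) * (fun z => charX r z t)^`()%classic y,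
      (exists S : R -> Xspace alpha -> Xspace alpha,
          U0_positive_semigroup r S) <->
        (forall t, 0 <= t -> (growth r t < +oo)%E) /\
        locally_bounded_nneg (growth r),
      forall S : R -> Xspace alpha -> Xspace alpha,
        U0_positive_semigroup r S ->
        forall t, 0 <= t ->
          op_norm (S t) =
          ereal_sup [set (chary r x t `^ alpha / x `^ alpha)%:E
                    | x in `]0, +oo[] &
      forall C : R, ereal_sup [set (r z / z)%:E | z in `]0, +oo[] = C%:E ->
        (exists S : R -> Xspace alpha -> Xspace alpha,
          U0_positive_semigroup r S) /\
        forall S : R -> Xspace alpha -> Xspace alpha,
          U0_positive_semigroup r S ->
          forall t, 0 <= t -> (op_norm (S t) <= (expR (alpha * C * t))%:E)%E].
Proof.
have alpha_ge0 := ltW halpha.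
have generates : (forall t : R, 0 <= t -> (growth r t < +oo)%E) ->
    exists S : R -> Xspace alpha -> Xspace alpha, U0_positive_semigroup r S.
  by move=> fin; exists (@flow_op R r alpha); exact: flow_op_semigroup.
split.
- move=> t y t0 y0.
  have [dX X'] := is_derive_charX hr_cont hr_pos hr_0 hr_oo y0 t0.
  split => // f.
  by rewrite derive1E X' /U0 -mulrA mulrCA.
- split => [[S SU]|[fin _]]; last exact: generates.
  have fin (t : R) : 0 <= t -> (growth r t < +oo)%E.
    exact: (U0_semigroup_growth hr_cont hr_pos hr_0 hr_oo alpha_ge0 halpha SU).
  split => //; exact: locally_bounded_growth.
- by move=> S SU t t0; exact: (U0_semigroup_op_norm hr_cont hr_pos hr_0 hr_oo).
- move=> C supC.
  have rC (z : R) : 0 < z -> r z <= C * z.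
    move=> z0; rewrite -ler_pdivrMr// -lee_fin -supC.
    by apply: ereal_sup_ubound; exists z => //=; rewrite in_itv/= z0.
  have gC (t : R) : 0 <= t -> (growth r t <= (expR (C * t))%:E)%E.
    by move=> t0; exact: growth_exp.
  split=> [|S SU t t0].
    by apply: generates => t t0; rewrite (le_lt_trans (gC t t0))// ltry.
  rewrite (U0_semigroup_op_norm hr_cont hr_pos hr_0 hr_oo alpha_ge0 SU t0).
  rewrite -mulrA mulrC expRM.
  apply/(flow_ratio_leP hr_cont hr_pos hr_0 hr_oo) => //.
  exact: (growth_weight_bound hr_cont hr_pos hr_0 hr_oo alpha_ge0 t0 (gC t t0)).
Qed.
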